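(* Suppose there exist a continuously differentiable function $V:\mathbb{R}^{2n+q}\to\mathbb{R}$, positive reals $k,c_1,c_2,c_3$, and a neighborhood $\mathcal{U}\subset\mathbb{R}^{2n}$ of $0$ such that $c_1|x|_{\mathcal{A}}^k\le V(x)\le c_2|x|_{\mathcal{A}}^k$ for all $x\in\mathcal{C}$; $\langle\nabla V(x),f(x)\rangle\le-c_3V(x)$ for all $x\in\mathcal{U}\times\mathcal{T}$; and $V(g)-V(x)\le0$ for all $x\in\mathcal{D}$, $g\in G(x)$. Then the set $\mathcal{A}$ is exponentially stable for $\mathcal{H}_{cl}$. Moreover, the basin of attraction of $\mathcal{A}$ contains every sublevel set $\{x\in\mathcal{C}:V(x)\le c\}$ of the restriction of $V$ to $\mathcal{C}$ that is included in $\mathcal{U}\times\mathcal{T}$.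
   Context: Setting: integers $n,m\ge1$, $1\le q\le n$, $n_1,\dots,n_q\ge1$ with $\sum n_i=n$; $\mathcal{N}=\{1,\dots,q\}$; $A\in\mathbb{R}^{n\times n}$, $B\in\mathbb{R}^{n\times m}$, $K\in\mathbb{R}^{m\times n}$, $\bar u\in\mathbb{R}^m$ with $\bar u_i>0$; positive reals $T_1^{(i)}\le T_2^{(i)}$. $\mathfrak{sat}_{\bar u}(v)=(\operatorname{sat}_1(v_1),\dots,\operatorname{sat}_m(v_m))$, $\operatorname{sat}_i(s)=\min(|s|,\bar u_i)\operatorname{sign}(s)$, $\mathfrak{dz}_{\bar u}(y)=\mathfrak{sat}_{\bar u}(y)-y$; $A_{cl}=\begin{bmatrix}A+BK&-BK\\0&A\end{bmatrix}$, $B_{cl}=\begin{bmatrix}B\\0\end{bmatrix}$, $K_{cl}=[K\ \ -K]$. State $x=(x_p,\tilde\eta,\tau)\in\mathbb{R}^n\times\mathbb{R}^n\times\mathbb{R}^q$, $\bar x=(x_p,\tilde\eta)$, $\tilde\eta=(\tilde\eta^{(1)},\dots,\tilde\eta^{(q)})$, $\tilde\eta^{(i)}\in\mathbb{R}^{n_i}$; $\mathcal{T}=\prod_i[0,T_2^{(i)}]$. $\mathcal{H}_{cl}$: $\dot x=f(x)$ on $\mathcal{C}=\mathbb{R}^{2n}\times\mathcal{T}$ with $f(x)=(A_{cl}\bar x+B_{cl}\mathfrak{dz}_{\bar u}(K_{cl}\bar x),-\mathbf{1}_q)$; $x^+\in G(x)$ on $\mathcal{D}=\mathbb{R}^{2n}\times\bigcup_i\mathcal{D}_i$,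 $\mathcal{D}_i=\{\tau\in\mathcal{T}:\tau_i=0\}$, $G(x)=\bigcup_{i:\tau\in\mathcal{D}_i}\{x_p\}\times\{h_i(\tilde\eta)\}\times\widehat{\mathcal{G}}_i(\tau)$, where $h_i(\tilde\eta)$ replaces the block $\tilde\eta^{(i)}$ by $0$ and keeps the others, and $\widehat{\mathcal{G}}_i(\tau)=\{\chi\in\mathbb{R}^q:\chi_i\in[T_1^{(i)},T_2^{(i)}],\chi_k=\tau_k\ \forall k\ne i\}$. Solutions in the sense of Goebel–Sanfelice–Teel. $\mathcal{A}=\{0\}\times\mathcal{T}\subset\mathbb{R}^{2n}\times\mathbb{R}^q$, $|x|_{\mathcal{A}}$ distance to $\mathcal{A}$. $\mathcal{A}$ is exponentially stable if there exist $\kappa,\lambda,\mu>0$ such that every maximal solution $\phi$ with $|\phi(0,0)|_{\mathcal{A}}\le\mu$ is complete and $|\phi(t,j)|_{\mathcal{A}}\le\kappa e^{-\lambda(t+j)}|\phi(0,0)|_{\mathcal{A}}$ for all $(t,j)\in\operatorname{dom}\phi$; the basin of attraction is the set of points from which every maximal solution is complete and converges to $\mathcal{A}$. *)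

(* Defs.v *)
From HB Require Import structures.
From mathcomp Require Import all_boot all_order all_algebra.
From mathcomp Require Import all_classical all_reals all_analysis.
Set Implicit Arguments. Unset Strict Implicit. Unset Printing Implicit Defensive.
Import Order.TTheory GRing.Theory Num.Theory numFieldNormedType.Exports.
Local Open Scope classical_set_scope.
Local Open Scope ring_scope.

Section HybridGeneric.
Variables (R : realType) (N : nat).

(* E is a hybrid time domain: for every (T,J) in E, the truncation
   E ∩ ([0,T] x {0..J}) is a compact hybrid time domain
   ∪_{j=0}^{J} [t_j, t_{j+1}] x {j} with 0 = t_0 <= t_1 <= ... <= t_{J+1}. *)
Definition hybrid_time_domain (E : set (R * nat)) : Prop :=
  forall (T : R) (J : nat), E (T, J) ->
    exists t : nat -> R,
      [/\ t 0%N = 0,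
          (forall j, (j <= J)%N -> t j <= t j.+1) &
          (forall (s : R) (k : nat),
              (E (s, k) /\ s <= T /\ (k <= J)%N) <->
              ((k <= J)%N /\ t k <= s /\ s <= t k.+1))].

Definition abs_cont_on (g : R -> 'cV[R]_N) (a b : R) : Prop :=
  forall e : R, 0 < e -> exists2 d : R, 0 < d &
    forall (K : nat) (u v : nat -> R),
      (forall k, (k < K)%N -> a <= u k /\ u k <= v k /\ v k <= b) ->
      (forall k l, (k < K)%N -> (l < K)%N -> k <> l ->
                   v k <= u l \/ v l <= u k) ->
      \sum_(k < K) (v k - u k) < d ->
      \sum_(k < K) `|g (v k) - g (u k)| < e.

Definition loc_abs_cont_on (g : R -> 'cV[R]_N) (I : set R) : Prop :=
  forall a b, I a -> I b -> a <= b -> abs_cont_on g a b.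

Definition hybrid_arc (dom : set (R * nat)) (phi : R -> nat -> 'cV[R]_N) : Prop :=
  [/\ hybrid_time_domain dom, dom (0, 0%N) &
      forall j, loc_abs_cont_on (fun t => phi t j) [set t | dom (t, j)]].

Definition is_solution (C : set 'cV[R]_N) (f : 'cV[R]_N -> 'cV[R]_N)
    (D : set 'cV[R]_N) (G : 'cV[R]_N -> set 'cV[R]_N)
    (dom : set (R * nat)) (phi : R -> nat -> 'cV[R]_N) : Prop :=
  [/\ hybrid_arc dom phi,
      (* (S0) *) closure C (phi 0 0%N) \/ D (phi 0 0%N),
      (forall j,
         (forall t, interior [set s | dom (s, j)] t -> C (phi t j)) /\
         (\forall t \ae (@lebesgue_measure R),
             [set s | dom (s, j)] t ->
             is_derive t (1 : R) (fun s => phi s j) (f (phi t j)))) &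
      (forall (t : R) (j : nat), dom (t, j) -> dom (t, j.+1) ->
         D (phi t j) /\ G (phi t j) (phi t j.+1))].

Definition maximal_solution C f D G dom phi : Prop :=
  is_solution C f D G dom phi /\
  forall dom' phi', is_solution C f D G dom' phi' -> dom `<=` dom' ->
    (forall t j, dom (t, j) -> phi' t j = phi t j) -> dom' = dom.

Definition complete_dom (dom : set (R * nat)) : Prop :=
  forall M : R, exists t j, dom (t, j) /\ M < t + j%:R.

(* exponential stability of a set, with distance function dist = |.|_A *)
Definition exp_stable C f D G (dist : 'cV[R]_N -> R) : Prop :=
  exists kappa lambda mu : R, [/\ 0 < kappa, 0 < lambda, 0 < mu &
    forall dom phi, maximal_solution C f D G dom phi ->
      dist (phi 0 0%N) <= mu ->
      complete_dom dom /\
      forall t j, dom (t, j) ->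
        dist (phi t j) <= kappa * expR (- lambda * (t + j%:R)) * dist (phi 0 0%N)].

Definition basin C f D G (dist : 'cV[R]_N -> R) : set 'cV[R]_N :=
  [set x | forall dom phi, maximal_solution C f D G dom phi -> phi 0 0%N = x ->
     complete_dom dom /\
     (forall e : R, 0 < e -> exists M : R,
        forall t j, dom (t, j) -> M <= t + j%:R -> dist (phi t j) <= e)].

Definition C1 (V : 'cV[R]_N -> R) : Prop :=
  (forall x, differentiable V x) /\ (forall v, continuous (fun x => 'd V x v)).

Definition eucl (v : 'cV[R]_N) : R := Num.sqrt (\sum_(i < N) v i 0 ^+ 2).
Definition dist_set (S : set 'cV[R]_N) (x : 'cV[R]_N) : R :=
  inf [set eucl (x - a) | a in S].

End HybridGeneric.

Section ClosedLoop.
Variables (R : realType) (n m q : nat).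

Definition sat_vec (ub : 'cV[R]_m) (v : 'cV[R]_m) : 'cV[R]_m :=
  \col_i (Order.min `|v i 0| (ub i 0) * Num.sg (v i 0)).
Definition dz_vec (ub : 'cV[R]_m) (v : 'cV[R]_m) : 'cV[R]_m := sat_vec ub v - v.

Definition Acl (A : 'M[R]_n) (B : 'M[R]_(n, m)) (K : 'M[R]_(m, n)) : 'M[R]_(n + n) :=
  block_mx (A + B *m K) (- (B *m K)) 0 A.
Definition Bcl (B : 'M[R]_(n, m)) : 'M[R]_(n + n, m) := col_mx B 0.
Definition Kcl (K : 'M[R]_(m, n)) : 'M[R]_(m, n + n) := row_mx K (- K).

Definition xbar (x : 'cV[R]_(n + n + q)) : 'cV[R]_(n + n) := usubmx x.
Definition xp (x : 'cV[R]_(n + n + q)) : 'cV[R]_n := usubmx (xbar x).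
Definition eta (x : 'cV[R]_(n + n + q)) : 'cV[R]_n := dsubmx (xbar x).
Definition tau (x : 'cV[R]_(n + n + q)) : 'cV[R]_q := dsubmx x.

Definition fcl A B K ub (x : 'cV[R]_(n + n + q)) : 'cV[R]_(n + n + q) :=
  col_mx (Acl A B K *m xbar x + Bcl B *m dz_vec ub (Kcl K *m xbar x))
         (const_mx (-1)).

Definition Tset (T2 : 'I_q -> R) : set 'cV[R]_q :=
  [set t | forall i, 0 <= t i 0 /\ t i 0 <= T2 i].
Definition Ccl T2 : set 'cV[R]_(n + n + q) := [set x | Tset T2 (tau x)].
Definition Di T2 (i : 'I_q) : set 'cV[R]_q := [set t | Tset T2 t /\ t i 0 = 0].
Definition Dcl T2 : set 'cV[R]_(n + n + q) := [set x | exists i, Di T2 i (tau x)].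

(* block structure of eta: block i occupies indices
   [bstart i, bstart i + ns i) *)
Definition bstart (ns : 'I_q -> nat) (i : 'I_q) : nat :=
  (\sum_(j < q | (j < i)%N) ns j)%N.
Definition hblk (ns : 'I_q -> nat) (i : 'I_q) (e : 'cV[R]_n) : 'cV[R]_n :=
  \col_k (if ((bstart ns i <= k) && (k < bstart ns i + ns i))%N then 0 else e k 0).

Definition Gcl ns T1 T2 (x : 'cV[R]_(n + n + q)) : set 'cV[R]_(n + n + q) :=
  [set g | exists i : 'I_q,
     [/\ Di T2 i (tau x), xp g = xp x, eta g = hblk ns i (eta x),
         T1 i <= tau g i 0 /\ tau g i 0 <= T2 i &
         forall k, k != i -> tau g k 0 = tau x k 0]].

Definition Aset T2 : set 'cV[R]_(n + n + q) :=
  [set a | xbar a = 0 /\ Tset T2 (tau a)].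
Definition distA T2 (x : 'cV[R]_(n + n + q)) : R := dist_set (Aset T2) x.

End ClosedLoop.

(* Main.v *)
(* Along a flow, V(phi) is absolutely continuous with derivative at most
   -c3 V(phi) almost everywhere, and jumps do not increase V; so V decays like
   exp(-c3 t) as long as the solution stays in a sublevel set included in
   U x T, and such sets are forward invariant.  A null set of exceptional times is
   handled by covering it with an open set of small measure and sweeping the
   interval by real induction.  Each jump raises sum_i tau_i / T1_i by at least
   one while flowing lowers it at a constant rate, so the number of jumps is
   affine in t and decay in t is decay in t + j.  A maximal solution is complete
   because a bounded one can be prolonged: by continuity at a missing right
   endpoint, by a jump when a timer vanishes, and otherwise by a flow given by
   Picard iteration, f being Lipschitz.  The definition of a hybrid time domain
   does not by itself exclude a domain that both flows and jumps from the same
   hybrid time; here a vanishing timer forbids flowing. *)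
Require Import Defs.
From HB Require Import structures.
From mathcomp Require Import all_boot all_order all_algebra.
From mathcomp Require Import all_classical all_reals all_analysis.
From mathcomp Require Import measurable_realfun ring lra.
Set Implicit Arguments. Unset Strict Implicit. Unset Printing Implicit Defensive.
Import Order.TTheory GRing.Theory Num.Theory numFieldNormedType.Exports.
Local Open Scope classical_set_scope.
Local Open Scope ring_scope.

(** * Real induction and absolutely continuous functions *)

(** The flow inequality is available only over [U], so decay and invariance of a sublevel set cannot
    be proved one after the other: each needs the other. Real induction carries both at once. Around
    each time, continuity of ['d V x (f x)] first makes [V] nonincreasing, which keeps the arc in
    the sublevel set; only then does the rate [c3] apply on the same short interval. Along
    solutions, integration is replaced by one comparison lemma, [ac_le], about functions that are
    Lipschitz in an absolutely continuous curve and in time. It serves for [V] along the arc, for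
    its product with an exponential, and for coordinates, that is, for timers and speed bounds.
    Decay bounds the distance to the attractor and the timers are bounded, hence so is the velocity.
    Arcs are thus Lipschitz between jumps, which yields the limit at a missing endpoint and reduces
    the gluing of arcs to a common Lipschitz constant. The constants of the final estimate do not
    depend on the sublevel set, so stability and the basin come from one statement. *)

Lemma real_induction (R : realType) (a b : R) (P : R -> Prop) :
  a <= b -> P a ->
  (forall x, a <= x -> x <= b -> exists2 d, 0 < d &
     forall y z, a <= y -> y <= x -> x <= z -> z <= b ->
       x - d < y -> z < x + d -> P y -> P z) ->
  P b.
Proof.
move=> ab Pa step.
pose E := [set x | [/\ a <= x, x <= b & P x]].
have Ea : E a by split.
have ubE : ubound E b by move=> x [].
have supE : has_sup E by split; [exists a|exists b].
have ac : a <= sup E by apply: ub_le_sup => //; exists b.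
have cb : sup E <= b by apply: ge_sup => //; exists a.
(* [step] is a gauge condition: it crosses [x] from any nearby [y <= x], so nothing has to be known
   at [x] itself. From a point of [E] close to its supremum it reaches either [b] or a point beyond
   the supremum. *)
have [d d0 stepc] := step _ ac cb.
have [y [ay yb Py] yc] := sup_adherent d0 supE.
have yle : y <= sup E by apply: ub_le_sup; [exists b|].
pose z := Num.min b (sup E + d / 2).
have zb : z <= b by rewrite /z ge_min lexx.
have cz : sup E <= z by rewrite /z le_min cb; lra.
have zd : z < sup E + d.
  by apply: (@le_lt_trans _ _ (sup E + d / 2)); [rewrite /z ge_min lexx orbT|lra].
have Pz : P z by apply: stepc Py.
have : z <= sup E by apply: ub_le_sup; [exists b|split => //; lra].
rewrite /z ge_min => /orP[bc|]; last lra.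
by have <- : z = b by apply/eqP; rewrite eq_le zb (le_trans bc).
Qed.

Lemma is_derive_straddle (R : realType) (W : R -> R) (x w e : R) :
  is_derive x 1 W w -> 0 < e -> exists2 d, 0 < d &
    forall y, `|y - x| < d -> `|W y - W x - w * (y - x)| <= e * `|y - x|.
Proof.
move=> [dW Ww] e0.
have cvW : h^-1 *: ((W \o shift x) (h *: 1) - W x) @[h --> 0^'] --> w.
  by rewrite -Ww; exact: dW.
move/cvgrPdist_le: cvW => /(_ _ e0).
case/nbhs_ballP => d /= d0 H; exists d => // y yx.
have [->|neq] := eqVneq y x; first by rewrite !subrr mulr0 subrr normr0 mulr0.
have h0 : y - x != 0 by rewrite subr_eq0.
have := H (y - x); rewrite /ball /= sub0r normrN => /(_ yx h0).
rewrite [_ *: 1]mulr1 subrK.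
have -> : W y - W x - w * (y - x) = - ((w - (y - x)^-1 *: (W y - W x)) * (y - x)).
  by rewrite /GRing.scale /=; field.
by rewrite normrN normrM => le; rewrite ler_wpM2r.
Qed.


Lemma le_itv_length (R : realType) (y z : R) : y <= z ->
  ((z - y)%:E <= (@lebesgue_measure R) `[y, z[%classic)%E.
Proof.
rewrite lebesgue_measure_itv /= lte_fin => yz.
by case: ifPn => [_|]; [rewrite EFinB|rewrite -leNgt lee_fin subr_le0].
Qed.

(** Where the derivative is known, [W] grows by at most [e] times the elapsed time; over the few
    intervals that cover the other times, its growth is controlled by that of [g], which absolute
    continuity makes small. Measuring [W] against [g] admits composites with [V] without a separate
    proof that they are absolutely continuous. *)
Lemma ac_le (R : realType) (N : nat) (g : R -> 'cV[R]_N) (W : R -> R)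
    (a b L : R) :
  a <= b -> 0 <= L -> abs_cont_on g a b ->
  (forall y z, a <= y -> y <= z -> z <= b ->
     `|W z - W y| <= L * (`|g z - g y| + (z - y))) ->
  (\forall t \ae (@lebesgue_measure R), a <= t -> t <= b ->
     exists2 w, is_derive t 1 W w & w <= 0) ->
  W b <= W a.
Proof.
move=> ab L0 acg lipW [N0 [mN0 N00 badN0]].
pose mu := @lebesgue_measure R.
suff key e : 0 < e -> W b - W a <= e * (b - a) + L * (e + e).
  apply/ler_addgt0Pr => e e0.
  pose M := (b - a) + 2 * L + 1.
  have M0 : 0 < M by rewrite /M; nra.
  have := key _ (divr_gt0 e0 M0).
  have -> : e / M * (b - a) + L * (e / M + e / M) = e - e / M.
    by rewrite /M; field; rewrite /M in M0; apply/eqP; nra.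
  by have := divr_gt0 e0 M0; lra.
move=> e0; have [d0 d00 acd] := acg _ e0.
(* [d0] comes from the absolute continuity of [g]; keeping [d] below [e] as well controls the time
   term of [lipW], the second [e] of the bound. *)
pose d := Num.min d0 e.
have dgt0 : 0 < d by rewrite lt_min d00.
have [Z [oO NO muO]] : exists Z : set R,
    [/\ open Z, N0 `<=` Z & (mu (Z `\` N0) < d%:E)%E].
  by apply: lebesgue_regularity_outer => //; rewrite [X in (X < _)%E]N00.
have mO : measurable Z by exact: open_measurable.
have muOd : (mu Z < d%:E)%E.
  have -> : Z = (Z `\` N0) `|` N0.
    by rewrite setDKU.
  apply: le_lt_trans (measureU2 _ _ _) _ => //; first exact: measurableD.
  by rewrite [X in (_ + X)%E]N00 adde0.
(* The intervals collected so far absorb the exceptional times. Their length is compared with the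
   measure of the swept part of [Z], not with [d], because that bound is additive when an interval
   is appended. *)
pose P x := exists K (u v : nat -> R),
  [/\ forall k, (k < K)%N -> [/\ a <= u k, u k <= v k & v k <= x],
      forall k l, (k < K)%N -> (l < K)%N -> k <> l -> v k <= u l \/ v l <= u k,
      ((\sum_(k < K) (v k - u k))%:E <= mu (Z `&` `[a, x[%classic))%E &
      W x - W a <= e * (x - a) + \sum_(k < K) `|W (v k) - W (u k)|].
have [K [u [v [uv disj len WK]]]] : P b.
  apply: real_induction ab _ _.
    exists 0%N, (fun=> 0), (fun=> 0); split => //.
      by rewrite big_ord0; exact: measure_ge0.
    by rewrite big_ord0 !subrr mulr0 addr0.
  move=> x ax xb.
  have mOI y : measurable (Z `&` `[a, y[%classic) by exact: measurableI.
  have [Ox|nOx] := pselect (Z x).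
    have /nbhs_ballP[r /= r0 Or] : nbhs x Z by move: oO => /(_ _ Ox).
    exists r => // y z ay yx xz zb xry zxr [K [u [v [uv disj len WK]]]].
    pose u' k := if (k < K)%N then u k else y.
    pose v' k := if (k < K)%N then v k else z.
    have sumE (F : R -> R -> R) : \sum_(k < K.+1) F (v' k) (u' k) =
        \sum_(k < K) F (v k) (u k) + F z y.
      rewrite big_ord_recr /= /u' /v' ltnn; congr (_ + _).
      by apply: eq_bigr => k _; rewrite ltn_ord.
    exists K.+1, u', v'; split.
    - move=> k; rewrite ltnS /u' /v' => kK; case: ifPn => [/uv[]|_]; first by split; lra.
      by split; lra.
    - move=> k l; rewrite !ltnS /u' /v' => kK lK kl.
      case: ifPn => kK'; case: ifPn => lK'.
      + exact: disj.
      + by left; have [] := uv _ kK'; lra.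
      + by right; have [] := uv _ lK'; lra.
      + exfalso; apply: kl; apply: (@eq_trans _ _ K); apply/eqP; rewrite eqn_leq.
          by rewrite kK leqNgt.
        by rewrite lK andbT leqNgt.
    - rewrite (sumE (fun p q => p - q)) EFinD.
      have -> : Z `&` `[a, z[%classic = (Z `&` `[a, y[%classic) `|` `[y, z[%classic.
        apply/seteqP; split => t /=; rewrite !in_itv /=.
          by move=> [Ot /andP[at_ tz]]; case: (ltP t y) => ty; [left|right];
             rewrite ?at_ ?ty.
        move=> [[Ot /andP[at_ ty]]|/andP[yt tz]]; split => //; try (apply/andP; split; lra).
        by apply: Or; rewrite /ball /= ltr_norml; apply/andP; split; lra.
      rewrite /mu measureU //; [|exact: mOI|]; last first.
        apply/seteqP; split => t //=; rewrite !in_itv /=.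
        by move=> [[_ /andP[_ ty]] /andP[yt _]]; lra.
      apply: leeD; first exact: len.
      exact: (le_itv_length (le_trans yx xz)).
    - rewrite (sumE (fun p q => `|W p - W q|)).
      have := ler_norm (W z - W y); nra.
  (* Outside [Z] no interval is added: the straddle estimates on both sides of [x] bound the growth
     of [W] by [e * (z - y)]. *)
  have [w [dW w0]] : exists w, is_derive x 1 W w /\ w <= 0.
    apply: contrapT => nW; apply: nOx; apply: NO; apply: badN0 => /= H.
    by have [w ? ?] := H ax xb; apply: nW; exists w.
  have [r r0 sr] := is_derive_straddle dW e0.
  exists r => // y z ay yx xz zb xry zxr [K [u [v [uv disj len WK]]]].
  exists K, u, v; split => //.
  - by move=> k /uv[]; split => //; lra.
  - apply: le_trans len _; apply: le_measure; rewrite ?inE; try exact: mOI.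
    by apply: setIS => t /=; rewrite !in_itv /= => /andP[-> ?]; lra.
  - have := sr y; have := sr z.
    rewrite [`|z - x|]ger0_norm ?[`|y - x|]ler0_norm; try lra.
    move=> /(_ ltac:(lra)) /ler_normlP[_ Hz] /(_ ltac:(lra)) /ler_normlP[Hy _].
    nra.
have lend : \sum_(k < K) (v k - u k) < d.
  rewrite -lte_fin; apply: le_lt_trans len _; apply: le_lt_trans muOd.
  by apply: le_measure; rewrite ?inE; [exact: measurableI|exact: mO|exact: subIsetl].
have gsum : \sum_(k < K) `|g (v k) - g (u k)| < e.
  apply: acd => //; first by move=> k /uv[? ? ?].
  by apply: lt_le_trans lend _; rewrite ge_min lexx.
apply: le_trans WK _; rewrite lerD2l.
apply: le_trans (_ : \sum_(k < K) L * (`|g (v k) - g (u k)| + (v k - u k)) <= _).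
  by apply: ler_sum => k _; have [? ? ?] := uv _ (ltn_ord k); apply: lipW.
rewrite -mulr_sumr ler_wpM2l // big_split /=; apply: lerD; apply: ltW => //.
by apply: lt_le_trans lend _; rewrite ge_min lexx orbT.
Qed.

(** * Continuously differentiable functions *)

Lemma coord_le_norm (R : realType) (N : nat) (x : 'cV[R]_N) i : `|x i 0| <= `|x|.
Proof.
rewrite [leRHS]/Num.Def.normr/= mx_normrE.
exact: (le_bigmax _ (fun ij : 'I_N * 'I_1 => `|x ij.1 ij.2|) (i, 0)).
Qed.

Lemma norm_le_coord (R : realType) (N : nat) (x : 'cV[R]_N) (M : R) :
  0 <= M -> (forall i, `|x i 0| <= M) -> `|x| <= M.
Proof.
move=> M0 xM; rewrite [leLHS]/Num.Def.normr/= mx_normrE.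
by apply: bigmax_le => // -[i j] _ /=; rewrite ord1.
Qed.

Lemma is_derive_coord (R : realType) (N : nat) (g : R -> 'cV[R]_N) (t : R) v i :
  is_derive t 1 g v -> is_derive t 1 (fun s => g s i 0) (v i 0).
Proof.
move=> [dg <-]; split; first by move/derivable_mxP: dg => /(_ i 0).
by rewrite derive_mx // mxE.
Qed.

Lemma is_derive_col (R : realType) (N : nat) (g : R -> 'cV[R]_N) (t : R)
    (v : 'cV[R]_N) :
  (forall i, is_derive t 1 (fun s => g s i 0) (v i 0)) -> is_derive t 1 g v.
Proof.
move=> dg; have dmx : derivable g t 1.
  by apply/derivable_mxP => i j; rewrite ord1; have [] := dg i.
split=> //; rewrite derive_mx //; apply/matrixP => i j.
by rewrite mxE ord1; have [] := dg i.
Qed.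

Lemma is_derive_comp_diff (R : realType) (N : nat) (V : 'cV[R]_N -> R)
    (g : R -> 'cV[R]_N) (t : R) v :
  differentiable V (g t) -> is_derive t 1 g v ->
  is_derive t 1 (fun s => V (g s)) ('d V (g t) v).
Proof.
move=> dV [dg gv]; have dg' : differentiable g t by apply/derivable1_diffP.
have dVg : differentiable (V \o g) t by apply: differentiable_comp.
split; first by apply/derivable1_diffP.
rewrite -/(V \o g) deriveE // diff_comp //= -gv deriveE //.
Qed.

Lemma diff_coordE (R : realType) (N : nat) (V : 'cV[R]_N -> R) (x v : 'cV[R]_N) :
  'd V x v = \sum_i v i 0 * 'd V x (delta_mx i 0).
Proof.
rewrite {1}(matrix_sum_delta v) linear_sum /=; apply: eq_bigr => i _.
by rewrite big_ord1 linearZ.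
Qed.

Lemma continuous_at_sumM (R : realType) (T : topologicalType) (I : Type)
    (r : seq I) (x : T) (F G : I -> T -> R) :
  (forall i, continuous_at x (F i)) -> (forall i, continuous_at x (G i)) ->
  continuous_at x (fun y => \sum_(i <- r) F i y * G i y).
Proof.
move=> cF cG; elim: r => [|i r IH].
  have -> : (fun y => \sum_(i <- [::]) F i y * G i y) = cst 0.
    by apply/funext => y; rewrite big_nil.
  exact: cst_continuous.
have -> : (fun y => \sum_(j <- i :: r) F j y * G j y) =
    (fun y => F i y * G i y) \+ (fun y => \sum_(j <- r) F j y * G j y).
  by apply/funext => y; rewrite big_cons.
apply: (@cvgD R R T _ _ _ _ _ _ _ IH).
exact: (@cvgM R T _ _ _ _ _ _ (cF i) (cG i)).
Qed.

(** [C1] gives continuity of the differential only in a fixed direction, whereas [f x] varies with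
    the point; expanding in the canonical basis separates the two dependences. *)
Lemma C1_diff_continuous (R : realType) (N : nat) (V : 'cV[R]_N -> R)
    (f : 'cV[R]_N -> 'cV[R]_N) :
  C1 V -> continuous f -> continuous (fun x => 'd V x (f x)).
Proof.
move=> [_ dV] cf x.
have -> : (fun x => 'd V x (f x)) =
    (fun x => \sum_i f x i 0 * 'd V x (delta_mx i 0)).
  by apply/funext => y; rewrite diff_coordE.
apply: continuous_at_sumM => i; last exact: dV.
exact: (continuous_comp (cf x) (@coord_continuous _ _ _ i 0 (f x))).
Qed.

Lemma norm_lt_of_dist (R : realType) (p q e : R) : `|p - q| < e -> `|q| < `|p| + e.
Proof.
move=> pq; rewrite addrC -ltrBlDr; apply: le_lt_trans pq.
by rewrite distrC; exact: lerB_dist.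
Qed.

Lemma convex_comb_lt (R : realType) (t p q r : R) :
  0 <= t -> t <= 1 -> p < r -> q < r -> (1 - t) * p + t * q < r.
Proof. by move=> t0 t1 pr qr; have [t05|t05] := leP t (1/2); nra. Qed.

Lemma C1_locally_lipschitz (R : realType) (N : nat) (V : 'cV[R]_N -> R)
    (x : 'cV[R]_N) :
  C1 V -> exists r L : R, [/\ 0 < r, 0 <= L &
    forall y z, `|y - x| < r -> `|z - x| < r -> `|V z - V y| <= L * `|z - y|].
Proof.
move=> [dV cdV].
(* Near [x] each partial derivative exceeds its modulus at [x] by less than one. Balls are convex,
   so the mean value theorem on the segment from [y] to [z] stays inside and gives [L]. *)
pose L := \sum_i (`|'d V x (delta_mx i 0)| + 1).
have L0 : 0 <= L by apply: sumr_ge0 => i _; rewrite addr_ge0.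
have /nbhs_ballP[r /= r0 rL] : nbhs x [set y | forall i,
    `|'d V y (delta_mx i 0)| < `|'d V x (delta_mx i 0)| + 1].
  apply: (@filter_forall _ _ (fun i => [set y |
    `|'d V y (delta_mx i 0)| < `|'d V x (delta_mx i 0)| + 1]) (nbhs x)) => i.
  have /cvgrPdist_lt /(_ 1 ltr01) := cdV (delta_mx i 0) x.
  by apply: filterS => y; exact: norm_lt_of_dist.
exists r, L; split => // y z yr zr.
pose g (t : R) := y + t *: (z - y).
have dg t : is_derive t (1 : R) g (z - y).
  apply: is_derive_col => i.
  have -> : (fun s => g s i 0) = cst (y i 0) + (z i 0 - y i 0) \*: id.
    by apply/funext => s; rewrite /g !mxE mulrC.
  by apply: is_derive_eq; rewrite !mxE add0r [LHS]mulr1.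
have dVg t : is_derive t (1 : R) (fun s => V (g s)) ('d V (g t) (z - y)).
  exact: is_derive_comp_diff.
have [t t01 HV] : exists2 t, t \in `[0, 1]%R &
    V (g 1) - V (g 0) = 'd V (g t) (z - y) * (1 - 0).
  apply: (@MVT_segment R (fun s => V (g s)) (fun t => 'd V (g t) (z - y))) => //.
  apply: continuous_subspaceT => t.
  by apply: differentiable_continuous; apply/derivable1_diffP; have [] := dVg t.
have g0 : g 0 = y by rewrite /g scale0r addr0.
have g1 : g 1 = z by rewrite /g scale1r addrC subrK.
move: HV; rewrite g0 g1 subr0 mulr1 => ->.
rewrite diff_coordE; apply: le_trans (ler_norm_sum _ _ _) _.
rewrite mulr_suml; apply: ler_sum => i _.
rewrite normrM mulrC ler_pM // ?coord_le_norm //.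
apply: ltW; apply: rL; rewrite -ball_normE /= /g.
move: t01; rewrite in_itv /= => /andP[t0 t1].
have -> : x - (y + t *: (z - y)) = (1 - t) *: (x - y) + t *: (x - z).
  rewrite !scalerBl !scalerBr !scale1r; apply/matrixP => a b; rewrite !mxE; ring.
apply: le_lt_trans (ler_normD _ _) _; rewrite !normrZ.
rewrite [`|1 - t|]ger0_norm ?subr_ge0 // [`|t|]ger0_norm // ![`|x - _|]distrC.
exact: convex_comb_lt.
Qed.

(** * The vector field is Lipschitz *)

Lemma mulmx_norm_le (R : realType) (p N : nat) (M : 'M[R]_(p, N)) (x : 'cV[R]_N) :
  `|M *m x| <= (\sum_i \sum_j `|M i j|) * `|x|.
Proof.
have S0 i : 0 <= \sum_j `|M i j| by apply: sumr_ge0.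
apply: norm_le_coord => [|i]; first by rewrite mulr_ge0 // sumr_ge0.
rewrite mxE; apply: le_trans (ler_norm_sum _ _ _) _.
apply: (@le_trans _ _ ((\sum_j `|M i j|) * `|x|)).
  rewrite mulr_suml; apply: ler_sum => j _.
  by rewrite normrM ler_wpM2l // coord_le_norm.
rewrite ler_wpM2r // (bigD1 i) //= lerDl; exact: sumr_ge0.
Qed.

Lemma usubmx_norm_le (R : realType) (p r : nat) (x : 'cV[R]_(p + r)) :
  `|usubmx x| <= `|x|.
Proof. by apply: norm_le_coord => // i; rewrite mxE coord_le_norm. Qed.

Lemma col_mx_norm_le (R : realType) (p r : nat) (x : 'cV[R]_p) (y : 'cV[R]_r) M :
  `|x| <= M -> `|y| <= M -> `|col_mx x y| <= M.
Proof.
move=> xM yM; apply: norm_le_coord => [|i]; first exact: le_trans xM.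
by rewrite mxE; case: (fintype.split i) => j; apply: le_trans (coord_le_norm _ _) _.
Qed.

(** Exhibits saturation as a clamp to an interval, a form whose Lipschitz constant 1 follows from
    monotonicity. *)
Lemma sat_scalarE (R : realType) (u s : R) : 0 < u ->
  Order.min `|s| u * Num.sg s = Num.max (- u) (Num.min s u).
Proof.
move=> u0; have [s0|s0|->] := ltgtP s 0; last first.
- by rewrite sgr0 mulr0 min_l ?ltW // max_r // oppr_le0 ltW.
- rewrite gtr0_norm // gtr0_sg // mulr1 max_r // le_min.
  by apply/andP; split; lra.
- rewrite ltr0_norm // ltr0_sg // mulrN1 (min_l (x:=s)) ?(ltW (lt_trans s0 u0)) //.
  have [su|us] := leP (- s) u.
    by rewrite opprK max_r // lerNl.
  by rewrite max_l // ltW // ltrNr.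
Qed.

Lemma clamp_lipschitz (R : realType) (u v s t : R) :
  `|Num.max v (Num.min s u) - Num.max v (Num.min t u)| <= `|s - t|.
Proof.
wlog st : s t / t <= s.
  move=> H; have [/H //|/ltW /H] := leP t s.
  by rewrite distrC [leRHS]distrC.
have h1 : Num.min t u <= Num.min s u by rewrite le_min !ge_min st lexx orbT.
have h2 : Num.max v (Num.min t u) <= Num.max v (Num.min s u).
  by rewrite ge_max !le_max h1 lexx orbT.
rewrite !ger0_norm ?subr_ge0 //.
rewrite lerBlDr ge_max; apply/andP; split.
  have : v <= Num.max v (Num.min t u) by rewrite le_max lexx.
  lra.
have : Num.min t u <= Num.max v (Num.min t u) by rewrite le_max lexx orbT.
have [su|us] := leP s u; have [tu|ut] := leP t u; lra.
Qed.

Lemma dz_vec_lipschitz (R : realType) (m : nat) (ub v w : 'cV[R]_m) :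
  (forall i, 0 < ub i 0) -> `|dz_vec ub v - dz_vec ub w| <= 2 * `|v - w|.
Proof.
move=> ub0; apply: norm_le_coord => [|i]; first by rewrite mulr_ge0.
rewrite !mxE !sat_scalarE //.
rewrite opprD addrACA -opprD; apply: le_trans (ler_normB _ _) _.
rewrite mulr_natl mulr2n; apply: lerD.
  apply: le_trans (clamp_lipschitz _ _ _ _) _.
  by have := coord_le_norm (v - w) i; rewrite !mxE.
by have := coord_le_norm (v - w) i; rewrite !mxE.
Qed.

Lemma fcl_lipschitz (R : realType) (n m q : nat) (A : 'M[R]_n) (B : 'M[R]_(n, m))
    (K : 'M[R]_(m, n)) (ub : 'cV[R]_m) :
  (forall i, 0 < ub i 0) -> exists2 L : R, 0 < L &
    forall x y : 'cV[R]_(n + n + q), `|fcl A B K ub x - fcl A B K ub y| <= L * `|x - y|.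
Proof.
move=> ub0.
pose S p r (M : 'M[R]_(p, r)) := \sum_i \sum_j `|M i j|.
have S0 p r (M : 'M[R]_(p, r)) : 0 <= S p r M.
  by apply: sumr_ge0 => i _; apply: sumr_ge0.
pose a := S _ _ (Acl A B K); pose b := S _ _ (Bcl B); pose c := S _ _ (Kcl K).
(* The factor [2] is the Lipschitz constant of the dead zone; the timer rows are constant and add
   nothing. The final [1] keeps the constant positive for later divisions. *)
exists (a + b * (2 * c) + 1) => [|x y].
  by rewrite ltr_wpDl // addr_ge0 // ?mulr_ge0 // ?mulr_ge0 // S0.
have M0 : 0 <= (a + b * (2 * c) + 1) * `|x - y|.
  by rewrite mulr_ge0 // addr_ge0 // addr_ge0 ?mulr_ge0 // ?mulr_ge0 // S0.
rewrite /fcl opp_col_mx add_col_mx subrr; apply: col_mx_norm_le; last by rewrite normr0.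
set v := xbar x; set w := xbar y.
have vw : `|v - w| <= `|x - y|.
  rewrite /v /w /xbar -linearB; exact: usubmx_norm_le.
have -> : Acl A B K *m v + Bcl B *m dz_vec ub (Kcl K *m v) -
   (Acl A B K *m w + Bcl B *m dz_vec ub (Kcl K *m w)) =
   Acl A B K *m (v - w) + Bcl B *m (dz_vec ub (Kcl K *m v) - dz_vec ub (Kcl K *m w)).
  by rewrite !mulmxBr opprD addrACA.
apply: le_trans (ler_normD _ _) _.
apply: (@le_trans _ _ (a * `|x - y| + b * (2 * (c * `|x - y|)))); last first.
  rewrite [leRHS](_ : _ = a * `|x - y| + b * (2 * (c * `|x - y|)) + `|x - y|).
    by rewrite lerDl.
  by move: `|x - y| a b c {M0 vw} => X a b c; ring.
apply: lerD; apply: le_trans (mulmx_norm_le _ _) _; apply: ler_pM => //; try exact: S0.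
apply: le_trans (dz_vec_lipschitz _ _ ub0) _; rewrite ler_wpM2l // -mulmxBr.
apply: le_trans (mulmx_norm_le _ _) _; apply: ler_pM => //; exact: S0.
Qed.

(** * Lipschitz and absolutely continuous maps *)

Lemma lipschitz_continuous (R : realType) (V W : normedModType R) (f : V -> W) (L : R) :
  0 < L -> (forall x y, `|f x - f y| <= L * `|x - y|) -> continuous f.
Proof.
move=> L0 Lf x; apply/cvgrPdist_lt => e e0; apply/nbhs_ballP.
exists (e / L) => /=; first exact: divr_gt0.
move=> y; rewrite -ball_normE /= ltr_pdivlMr // mulrC; exact: le_lt_trans.
Qed.

Lemma abs_cont_continuous (R : realType) (N : nat) (g : R -> 'cV[R]_N) (a b x e : R) :
  abs_cont_on g a b -> 0 < e -> a <= x -> x <= b -> exists2 d, 0 < d &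
    forall y, a <= y -> y <= b -> `|y - x| < d -> `|g y - g x| < e.
Proof.
move=> acg e0 ax xb; have [d d0 H] := acg _ e0; exists d => // y ay yb yx.
have H1 u v : a <= u -> u <= v -> v <= b -> v - u < d -> `|g v - g u| < e.
  move=> au uv vb vud; have := H 1%N (fun=> u) (fun=> v).
  rewrite !big_ord1; apply => //.
  by move=> k l; rewrite !ltnS !leqn0 => /eqP-> /eqP->.
have [xy|/ltW yx'] := leP x y.
  by apply: H1 => //; rewrite ger0_norm ?subr_ge0 // in yx.
by rewrite distrC; apply: H1 => //; rewrite distrC ger0_norm ?subr_ge0 // in yx.
Qed.

Lemma abs_cont_sub (R : realType) (N : nat) (g : R -> 'cV[R]_N) (a b c d : R) :
  a <= c -> d <= b -> abs_cont_on g a b -> abs_cont_on g c d.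
Proof.
move=> ac db acg e e0; have [r r0 H] := acg e e0; exists r => // K u v uv.
apply: H => k /uv[cu [uv' vd]]; split; first exact: le_trans cu.
by split => //; exact: le_trans db.
Qed.

Lemma lipschitz_abs_cont (R : realType) (N : nat) (g : R -> 'cV[R]_N) (a b M : R) :
  0 < M ->
  (forall y z, a <= y -> y <= z -> z <= b -> `|g z - g y| <= M * (z - y)) ->
  abs_cont_on g a b.
Proof.
move=> M0 Mg e e0; exists (e / M); first exact: divr_gt0.
move=> K u v uv _; rewrite ltr_pdivlMr // mulrC; apply: le_lt_trans.
rewrite mulr_sumr; apply: ler_sum => k _; have [? [? ?]] := uv _ (ltn_ord k).
exact: Mg.
Qed.

(** * Picard iteration *)

(** The intervals of centre [u i] and radius [r i] meet pairwise, hence on the line they share a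
    point: the supremum of the left endpoints. *)
Lemma real_limit_of_radii (R : realType) (I : Type) (i0 : I) (u r : I -> R) :
  (forall i j, `|u i - u j| <= r i + r j) ->
  exists l, forall i, `|l - u i| <= r i.
Proof.
move=> ur; pose E := range (fun i => u i - r i).
have ubE i : ubound E (u i + r i).
  move=> _ [j _ <-]; have := ur j i; rewrite ler_norml => /andP[_]; lra.
have E0 : E !=set0 by exists (u i0 - r i0), i0.
exists (sup E) => i; rewrite ler_norml; apply/andP; split.
  rewrite -lerBlDr opprK addrC; apply: ub_le_sup; first by exists (u i + r i).
  by exists i.
by rewrite lerBlDr addrC; apply: ge_sup.
Qed.

(* Both the limit of a Cauchy sequence and the extension of a Lipschitz map to
   an endpoint of its interval are of this form, [r] being the distance still
   to be covered. *)
Lemma limit_of_radii (R : realType) (N : nat) (I : Type) (i0 : I)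
    (u : I -> 'cV[R]_N) (r : I -> R) :
  (forall i j, `|u i - u j| <= r i + r j) ->
  exists l, forall i, `|l - u i| <= r i.
Proof.
move=> ur.
have r0 i : 0 <= r i by have := ur i i; rewrite subrr normr0; lra.
have /choice[l Hl] (a : 'I_N) : exists l, forall i, `|l - u i a 0| <= r i.
  apply: (real_limit_of_radii i0) => i j; apply: le_trans (ur i j).
  by have := coord_le_norm (u i - u j) a; rewrite !mxE.
exists (\col_a l a) => i; apply: norm_le_coord => // a.
by rewrite !mxE.
Qed.

Lemma le0_of_halves (R : realType) (x C : R) :
  (forall k : nat, x <= C / 2 ^+ k) -> x <= 0.
Proof.
move=> H; rewrite leNgt; apply/negP => x0.
have C0 : 0 <= C by have := H 0%N; rewrite expr0 divr1; lra.
pose k := Num.bound (C / x).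
have : C / x < k%:R by apply: archi_boundP; rewrite divr_ge0 // ltW.
rewrite ltr_pdivrMr // => Ck.
have := H k; rewrite ler_pdivlMr ?exprn_gt0 // => xk.
have : (k%:R : R) <= 2 ^+ k by rewrite -natrX ler_nat ltnW // ltn_expl.
by move=> k2; have := ler_wpM2l (ltW x0) k2; rewrite [x * k%:R]mulrC; lra.
Qed.

Lemma real_antiderivative (R : realType) (g : R -> R) (h : R) :
  continuous g ->
  exists F : R -> R, forall t, 0 <= t -> t <= h -> is_derive t 1 F (g t).
Proof.
move=> cg.
(* Integrating from [-1] rather than [0] puts [[0, h]] in the interior, so the derivative is
   two-sided even at the endpoints. *)
exists (fun x => (\int[@lebesgue_measure R]_(t in [set` `[(-1)%R, x]]) (g t))%R) => t t0 th.
have [||||dF F'] := @continuous_FTC1_closed R g (-1) t (h + 1).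
- lra.
- apply: continuous_compact_integrable; first exact: segment_compact.
  exact: continuous_subspaceT.
- lra.
- exact: cg.
exact: (DeriveDef dF (etrans (esym (derive1E _ _)) F')).
Qed.

Lemma antiderivative (R : realType) (N : nat) (g : R -> 'cV[R]_N) (h : R) :
  0 <= h -> continuous g ->
  exists F : R -> 'cV[R]_N, F 0 = 0 /\
    forall t, 0 <= t -> t <= h -> is_derive t 1 F (g t).
Proof.
move=> h0 cg.
have /choice[F HF] (i : 'I_N) : exists F : R -> R,
    forall t, 0 <= t -> t <= h -> is_derive t 1 F (g t i 0).
  apply: (@real_antiderivative R (fun t => g t i 0)) => t.
  exact: (continuous_comp (cg t) (@coord_continuous _ _ _ i 0 (g t))).
exists (fun t => \col_i (F i t - F i 0)); split.
  by apply/matrixP => i j; rewrite !mxE subrr.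
move=> t t0 th; apply: is_derive_col => i.
have -> : (fun s => (\col_j (F j s - F j 0)) i 0) = F i - cst (F i 0).
  by apply/funext => s; rewrite mxE.
have dF := HF i t t0 th.
by apply: is_derive_eq; rewrite subr0.
Qed.

Lemma is_derive_continuous (R : realType) (W : normedModType R) (F : R -> W) (t : R) w :
  is_derive t 1 F w -> continuous_at t F.
Proof.
by move=> [dF _]; apply: differentiable_continuous; apply/derivable1_diffP.
Qed.

(** There is no mean value equality for vectors, but in the sup norm the bound follows coordinate by
    coordinate with no loss in the constant. *)
Lemma mean_value_ineq (R : realType) (N : nat) (F F' : R -> 'cV[R]_N) (a b M : R) :
  a <= b ->
  (forall t, a <= t -> t <= b -> is_derive t 1 F (F' t)) ->
  (forall t, a <= t -> t <= b -> `|F' t| <= M) ->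
  `|F b - F a| <= M * (b - a).
Proof.
move=> ab dF FM.
have M0 : 0 <= M by apply: le_trans (FM a _ _).
apply: norm_le_coord => [|i]; first by rewrite mulr_ge0 // subr_ge0.
have dFi t : a <= t -> t <= b -> is_derive t 1 (fun s => F s i 0) (F' t i 0).
  by move=> at_ tb; apply: is_derive_coord; exact: dF.
have [||t] := @MVT_segment R (fun s => F s i 0) (fun s => F' s i 0) a b ab.
- by move=> x; rewrite in_itv /= => /andP[ax xb]; apply: dFi; exact: ltW.
- apply: derivable_within_continuous => x; rewrite in_itv /= => /andP[ax xb].
  by have [] := dFi x ax xb.
rewrite in_itv /= => /andP[at_ tb] E; rewrite !mxE E normrM.
rewrite [`|b - a|]ger0_norm ?subr_ge0 // ler_wpM2r ?subr_ge0 //.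
exact: le_trans (coord_le_norm _ _) (FM t at_ tb).
Qed.

Section Picard.
Variables (R : realType) (N : nat) (f : 'cV[R]_N -> 'cV[R]_N) (L h : R) (x0 : 'cV[R]_N).
Hypotheses (L0 : 0 < L) (Lf : forall x y, `|f x - f y| <= L * `|x - y|).
Hypotheses (h0 : 0 < h) (hL : h * L <= 1 / 2).

(** Freezing time outside [[0, h]] makes the iterates global continuous functions, so uniform bounds
    can be stated over all of [R]. *)
Let clamp (t : R) : R := Num.max 0 (Num.min t h).

Let clamp_ge0 t : 0 <= clamp t. Proof. by rewrite /clamp le_max lexx. Qed.

Let clamp_leh t : clamp t <= h.
Proof. by rewrite /clamp ge_max (ltW h0) ge_min lexx orbT. Qed.

Let clampE t : 0 <= t -> t <= h -> clamp t = t.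
Proof. by move=> t0 th; rewrite /clamp min_l // max_r. Qed.

Let clamp_lip s t : `|clamp s - clamp t| <= `|s - t|.
Proof. exact: clamp_lipschitz. Qed.

Let fy_continuous (y : R -> 'cV[R]_N) : continuous y -> continuous (f \o y).
Proof.
by move=> cy t; apply: (continuous_comp (cy t)); exact: (lipschitz_continuous L0 Lf).
Qed.

(** Antiderivatives are only known to exist; choice turns them into an operator that can be
    iterated. Its value on discontinuous curves is arbitrary. *)
Let picard_step_ex : exists T : (R -> 'cV[R]_N) -> (R -> 'cV[R]_N),
  forall y, continuous y -> exists F : R -> 'cV[R]_N,
    [/\ F 0 = 0, forall t, 0 <= t -> t <= h -> is_derive t 1 F (f (y t)) &
        forall t, T y t = x0 + F (clamp t)].
Proof.
have /choice[T HT] (y : R -> 'cV[R]_N) : exists Ty : R -> 'cV[R]_N,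
    continuous y -> exists F : R -> 'cV[R]_N,
    [/\ F 0 = 0, forall t, 0 <= t -> t <= h -> is_derive t 1 F (f (y t)) &
        forall t, Ty t = x0 + F (clamp t)].
  have [cy|ncy] := pselect (continuous y); last by exists y.
  have [F [F0 dF]] := antiderivative (ltW h0) (fy_continuous cy).
  by exists (fun t => x0 + F (clamp t)) => _; exists F.
by exists T.
Qed.

(** The operator halves uniform distances because [h * L <= 1 / 2]. The equation is claimed on the
    open interval only, since the clamped curve may have corners at [0] and [h]. *)
Lemma picard_lindelof : exists (y : R -> 'cV[R]_N) (M : R),
  [/\ 0 < M, y 0 = x0,
      forall t, 0 < t -> t < h -> is_derive t 1 y (f (y t)) &
      forall s t, `|y t - y s| <= M * `|t - s|].
Proof.
have [T HT] := picard_step_ex.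
have Tlip y M : continuous y -> (forall t, `|f (y t)| <= M) ->
    forall s t, `|T y t - T y s| <= M * `|t - s|.
  move=> cy yM s t; have [F [F0 dF TE]] := HT y cy.
  have M0 : 0 <= M by apply: le_trans (yM 0).
  apply: (@le_trans _ _ (M * `|clamp t - clamp s|)); last by rewrite ler_wpM2l.
  rewrite !TE opprD addrACA subrr add0r.
  wlog st : s t / clamp s <= clamp t.
    by move=> H; have [/H //|/ltW /H] := leP (clamp s) (clamp t);
       rewrite distrC [in leRHS]distrC.
  rewrite [in leRHS]ger0_norm ?subr_ge0 //.
  apply: (mean_value_ineq st) => r r1 r2; last exact: yM.
  by apply: dF; [exact: le_trans r1|exact: le_trans r2 _].
have Tcts y : continuous y -> continuous (T y).
  move=> cy t; have [F [F0 dF TE]] := HT y cy.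
  have -> : T y = (fun t => x0 + (F \o clamp) t) by apply/funext => s; rewrite TE.
  have cc : continuous_at t clamp.
    by apply: (@lipschitz_continuous R _ _ clamp 1) => // a b; rewrite mul1r.
  have cF : continuous_at (clamp t) F.
    by apply: is_derive_continuous; apply: dF.
  exact: (@cvgD R _ _ _ _ _ _ _ _ (cvg_cst x0) (continuous_comp cc cF)).
have Tcontr y z D : continuous y -> continuous z ->
    (forall t, `|y t - z t| <= D) -> forall t, `|T y t - T z t| <= D / 2.
  move=> cy cz yzD t.
  have [F [F0 dF ->]] := HT y cy; have [G [G0 dG ->]] := HT z cz.
  rewrite opprD addrACA subrr add0r.
  have D0 : 0 <= D by apply: le_trans (yzD 0).
  have := @mean_value_ineq R N (F - G) (fun t => f (y t) - f (z t)) 0 (clamp t) (L * D).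
  rewrite !fctE F0 G0 subrr subr0 subr0 => /(_ (clamp_ge0 t)) H.
  apply: le_trans (H _ _) _.
  - move=> s s0 s1; have sh := le_trans s1 (clamp_leh t).
    by have dFs := dF s s0 sh; have dGs := dG s s0 sh; exact: is_deriveB.
  - by move=> s _ _; apply: le_trans (Lf _ _) _; rewrite ler_wpM2l // ltW.
  - apply: (@le_trans _ _ (L * D * h)).
      by rewrite ler_wpM2l // mulr_ge0 // ltW.
    by rewrite mulrAC [L * h]mulrC [D / 2]mulrC ler_wpM2r // -div1r.
pose Y k := iter k T (cst x0).
have cY k : continuous (Y k).
  by elim: k => [|k IH]; [exact: cst_continuous|exact: Tcts].
(* [D] bounds the first increment, [f] being constantly [f x0] along the initial iterate; later
   increments halve. *)
pose D := `|f x0| * h.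
have D0 : 0 <= D by rewrite mulr_ge0 // ltW.
have step k t : `|Y k.+1 t - Y k t| <= D / 2 ^+ k.
  elim: k t => [|k IH] t; last first.
    by rewrite exprSr invfM mulrA; exact: (Tcontr _ _ _ (cY k.+1) (cY k) IH t).
  have [F [F0 dF TE]] := HT _ (cY 0%N).
  rewrite expr0 divr1 /= TE addrC addKr.
  have := mean_value_ineq (clamp_ge0 t) (fun s s0 s1 => dF s s0 (le_trans s1 (clamp_leh t)))
    (M := `|f x0|).
  rewrite F0 !subr0 => H; apply: le_trans (H _) _; first by [].
  by rewrite ler_wpM2l.
(* The subtracted term is the geometric tail still to come; it is what lets the induction on [m]
   close. *)
have far k m t : `|Y (k + m)%N t - Y k t| <= 2 * D / 2 ^+ k - 2 * D / 2 ^+ (k + m).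
  elim: m => [|m IH]; first by rewrite addn0 !subrr normr0.
  rewrite addnS; apply: le_trans (ler_distD (Y (k + m)%N t) _ _) _.
  have := lerD (step (k + m)%N t) IH.
  rewrite exprSr; have : 2 ^+ (k + m) != 0 :> R by rewrite expf_neq0.
  move: (2 ^+ (k + m)) (2 * D / 2 ^+ k) => p c p0 /le_trans; apply.
  by rewrite le_eqVlt; apply/orP; left; apply/eqP; field.
pose r k : R := 2 * D / 2 ^+ k.
have r0 k : 0 <= r k by rewrite /r divr_ge0 // mulr_ge0.
have cauchy t k l : `|Y k t - Y l t| <= r k + r l.
  wlog kl : k l / (k <= l)%N.
    by move=> H; have [/H //|/ltnW /H] := leqP k l; rewrite distrC [r l + _]addrC.
  rewrite distrC -(subnKC kl); apply: le_trans (far _ _ _) _.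
  by rewrite -!/(r _); have := r0 (k + (l - k))%N; have := r0 k; lra.
have /choice[y Hy] t : exists l, forall k, `|l - Y k t| <= r k.
  exact: (limit_of_radii 0%N (cauchy t)).
(* All iterates stay within [2 * D] of [x0], so [M] bounds [f] along them and is a Lipschitz
   constant that passes to the limit. *)
pose M := `|f x0| + L * (2 * D) + 1.
have YM k t : `|f (Y k t)| <= M.
  have := Lf (Y k t) x0; have := far 0%N k t; rewrite add0n expr0 divr1 -/(r k) => h1 h2.
  have h3 : `|f (Y k t)| <= `|f (Y k t) - f x0| + `|f x0|.
    by rewrite -{1}[f (Y k t)](subrK (f x0)); exact: ler_normD.
  have h4 : L * `|Y k t - x0| <= L * (2 * D).
    by rewrite ler_wpM2l ?(ltW L0) //; apply: le_trans h1 _; rewrite gerBl.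
  by rewrite /M; move: h2 h3 h4; lra.
have M0 : 0 < M.
  by rewrite ltr_wpDl // addr_ge0 // !mulr_ge0 // ltW.
have ylip s t : `|y t - y s| <= M * `|t - s|.
  rewrite -subr_le0; apply: (@le0_of_halves _ _ (4 * D)) => k.
  have h1 := Hy t k.+1; have h2 := Hy s k.+1; have h3 := Tlip _ _ (cY k) (YM k) s t.
  have h4 : `|y t - y s| <= `|y t - Y k.+1 t| + `|Y k.+1 t - Y k.+1 s| + `|y s - Y k.+1 s|.
    rewrite [`|y s - _|]distrC; apply: le_trans (ler_distD (Y k.+1 s) _ _) _.
    by rewrite lerD2r ler_distD.
  have h5 : 4 * D / 2 ^+ k = r k.+1 + r k.+1 + r k.+1 + r k.+1.
    rewrite /r exprSr; have : 2 ^+ k != 0 :> R by rewrite expf_neq0.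
    by move: (2 ^+ k) => p p0; field.
  have h6 := r0 k.+1.
  by rewrite h5; move: h1 h2 h3 h4 h6; rewrite /Y /=; lra.
have cy : continuous y.
  by apply: (@lipschitz_continuous R _ _ y M) => // s t; exact: ylip.
(* The defect splits into [r k / 2] from contraction and [r k.+1] from convergence, which add up to
   [r k]. *)
have Ty t : T y t = y t.
  apply/eqP; rewrite -subr_eq0 -normr_le0; apply: (@le0_of_halves _ _ (2 * D)) => k.
  apply: le_trans (ler_distD (Y k.+1 t) _ _) _.
  have h1 : `|T y t - Y k.+1 t| <= r k / 2 by apply: Tcontr => // s; exact: Hy.
  have h2 := Hy t k.+1; rewrite distrC in h2.
  have h3 : r k = r k / 2 + r k.+1.
    rewrite /r exprSr; have : 2 ^+ k != 0 :> R by rewrite expf_neq0.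
    by move: (2 ^+ k) => p p0; field.
  by rewrite -/(r k) h3 lerD.
have [F [F0 dF TE]] := HT y cy.
exists y, M; split => //.
  by rewrite -Ty TE clampE ?F0 ?addr0 // ltW.
move=> t t0 th.
have dt : is_derive t 1 (cst x0 + F) (f (y t)).
  have dFt := dF t (ltW t0) (ltW th).
  by apply: is_derive_eq; rewrite add0r.
apply: near_eq_is_derive dt => //; near=> s.
rewrite -Ty TE clampE //; near: s.
  by apply: filterS (lt_nbhsr t0) => s /ltW.
by apply: filterS (lt_nbhsl th) => s /ltW.
Unshelve. all: by end_near.
Qed.
End Picard.

(** * Hybrid time domains *)

Lemma htd_convex (R : realType) (E : set (R * nat)) a b s j :
  hybrid_time_domain E -> E (a, j) -> E (b, j) -> a <= s -> s <= b -> E (s, j).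
Proof.
move=> hE Ea Eb as_ sb; have [t [_ _ tE]] := hE _ _ Eb.
have [_ [ta _]] := (tE a j).1 (conj Ea (conj (le_trans as_ sb) (leqnn j))).
have [_ [_ tb]] := (tE b j).1 (conj Eb (conj (lexx b) (leqnn j))).
have [] // := (tE s j).2.
by split => //; split; [exact: le_trans as_|exact: le_trans tb].
Qed.

(** Truncation at the target hybrid time leaves finitely many flow intervals and jumps to walk
    through; the induction is on the number of jumps. *)
Lemma hybrid_ind (R : realType) (E : set (R * nat)) (P : R -> nat -> Prop) :
  hybrid_time_domain E -> P 0 0%N ->
  (forall s t j, E (s, j) -> E (t, j) -> s <= t -> P s j -> P t j) ->
  (forall t j, E (t, j) -> E (t, j.+1) -> P t j -> P t j.+1) ->
  forall t j, E (t, j) -> P t j.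
Proof.
move=> hE P0 flow jump T J ETJ; have [t [t0 tm tE]] := hE _ _ ETJ.
have El k : (k <= J)%N -> E (t k, k).
  by move=> kJ; have [] // := (tE (t k) k).2 (conj kJ (conj (lexx _) (tm k kJ))).
have Er k : (k <= J)%N -> E (t k.+1, k).
  by move=> kJ; have [] // := (tE (t k.+1) k).2 (conj kJ (conj (tm k kJ) (lexx _))).
have Pk k : (k <= J)%N -> P (t k) k.
  elim: k => [|k IH] kJ; first by rewrite t0.
  have kJ' := ltnW kJ; apply: jump; [exact: Er|exact: El|].
  by apply: (flow (t k)); [exact: El|exact: Er|exact: tm|exact: IH].
apply: (flow (t J)) => //; [exact: El| |exact: Pk].
by have [_ []] := (tE T J).1 (conj ETJ (conj (lexx T) (leqnn J))).
Qed.

Lemma htd_ge0 (R : realType) (E : set (R * nat)) t j :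
  hybrid_time_domain E -> E (t, j) -> 0 <= t.
Proof.
move=> hE; apply: (@hybrid_ind _ _ (fun t _ => 0 <= t) hE) => // s r k _ _ sr s0.
exact: le_trans sr.
Qed.

Lemma htd_jump_time (R : realType) (E : set (R * nat)) (t : R) (k J : nat) :
  hybrid_time_domain E -> E (t, J) -> (k < J)%N ->
  exists r, [/\ E (r, k), E (r, k.+1) & r <= t].
Proof.
move=> hE EtJ kJ; have [u [u0 um uE]] := hE _ _ EtJ; exists (u k.+1).
have [h1 [h2 _]] := (uE (u k.+1) k.+1).2 (conj kJ (conj (lexx _) (um _ kJ))).
have [h3 _] := (uE (u k.+1) k).2 (conj (ltnW kJ) (conj (um _ (ltnW kJ)) (lexx _))).
by split.
Qed.

(** The bound [t0] on lower components matters: a domain may contain a lower component that outlasts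
    a later jump, and prolonging component [J] would bring its extra points into the truncations. *)
Lemma htd_extend_flow (R : realType) (E : set (R * nat)) (J : nat) (t0 T' : R) :
  hybrid_time_domain E -> E (t0, J) ->
  (forall s k, E (s, k) -> (k <= J)%N) ->
  (forall s k, (k < J)%N -> E (s, k) -> s <= t0) ->
  hybrid_time_domain [set p | E p \/ [/\ p.2 = J, t0 <= p.1 & p.1 <= T']].
Proof.
move=> hE Et0 topJ mono T J' ETJ.
have [JJ|JJ] := ltnP J' J.
  have EJ : E (T, J') by case: ETJ => //= -[JE]; move: JJ; rewrite JE ltnn.
  have [t [t_0 tm tE]] := hE _ _ EJ; exists t; split => // s k; split.
    move=> [[Es|[/= kJ _ _]] [sT kJ']]; first exact/tE.
    by move: JJ; rewrite -kJ ltnNge kJ'.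
  by move=> /tE[? ?]; split => //; left.
have JE : J' = J.
  by case: ETJ => [/topJ J'J|[]//]; apply/eqP; rewrite eqn_leq J'J.
move: ETJ => {JJ}; rewrite JE => ETJ.
have [t [t_0 tm tE]] := hE _ _ Et0.
have [_ [tJ0 _]] := (tE t0 J).1 (conj Et0 (conj (lexx t0) (leqnn J))).
have tJT : t J <= T.
  case: ETJ => [ET|[_ /= t0T _]]; last exact: le_trans t0T.
  have [Tt0|/ltW t0T] := leP T t0; last exact: le_trans t0T.
  by have [_ []] := (tE T J).1 (conj ET (conj Tt0 (leqnn J))).
exists (fun j => if (j <= J)%N then t j else T); split => //.
  move=> j jJ; rewrite jJ; have [jJ'|Jj] := ltnP j J; first exact: tm.
  by have -> : j = J by apply/eqP; rewrite eqn_leq jJ.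
move=> s k; have [kJ|Jk] := ltnP k J; last first.
  split=> [[Es [sT kJ]]|[kJ]].
    have kE : k = J by apply/eqP; rewrite eqn_leq kJ.
    rewrite kE leqnn; split => //; split => //; rewrite kE in Es.
    case: Es => [Es|[_ /= t0s _]]; last exact: le_trans t0s.
    have [st0|/ltW t0s] := leP s t0; last exact: le_trans t0s.
    by have [_ []] := (tE s J).1 (conj Es (conj st0 (leqnn J))).
  have -> : k = J by apply/eqP; rewrite eqn_leq kJ.
  rewrite leqnn => -[ts sT]; split; last by [].
  have [st0|/ltW t0s] := leP s t0.
    left; have [] // := (tE s J).2; split => //; split => //; apply: le_trans st0 _.
    by have [_ []] := (tE t0 J).1 (conj Et0 (conj (lexx t0) (leqnn J))).
  case: ETJ => [ET|[_ /= _ TT']]; first by left; apply: htd_convex Et0 ET _ _.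
  by right; split => //=; exact: le_trans TT'.
rewrite (ltnW kJ); split=> [[Es [sT _]]|[_ ts]].
  have Esk : E (s, k) by case: Es => // -[/= kE]; move: kJ; rewrite kE ltnn.
  by have [_] := (tE s k).1 (conj Esk (conj (mono _ _ kJ Esk) (ltnW kJ))).
have [Es [st0 _]] := (tE s k).2 (conj (ltnW kJ) ts).
split; [by left|split => //].
have tmJ i : (k.+1 + i <= J)%N -> t k.+1 <= t (k.+1 + i)%N.
  elim: i => [|i IH]; first by rewrite addn0.
  by rewrite addnS => kiJ; apply: le_trans (IH (ltnW kiJ)) (tm _ (ltnW kiJ)).
apply: le_trans ts.2 (le_trans _ tJT).
by have := tmJ (J - k.+1)%N; rewrite subnKC // leqnn; apply.
Qed.

Lemma htd_extend_jump (R : realType) (E : set (R * nat)) (J : nat) (T : R) :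
  hybrid_time_domain E -> E (T, J) -> (forall s k, E (s, k) -> (k <= J)%N) ->
  hybrid_time_domain [set p | E p \/ p = (T, J.+1)].
Proof.
move=> hE ETJ topJ T' J' [E'|[-> ->]].
  have [t [t_0 tm tE]] := hE _ _ E'; exists t; split => // s k; split.
    move=> [[Es|[_ kE]] [sT kJ']]; first exact/tE.
    by have := leq_trans kJ' (topJ _ _ E'); rewrite kE ltnn.
  by move=> /tE[? ?]; split => //; left.
have [t [t_0 tm tE]] := hE _ _ ETJ.
have tJ : t J.+1 = T.
  have [_ [_ h1]] := (tE T J).1 (conj ETJ (conj (lexx T) (leqnn J))).
  have [_ [h2 _]] := (tE (t J.+1) J).2 (conj (leqnn J) (conj (tm J (leqnn J)) (lexx _))).
  by apply/eqP; rewrite eq_le h1 h2.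
(* The last node is repeated: component [J.+1] is the degenerate interval from [t J.+1], equal to
   [T], to [T]. *)
exists (fun j => if (j <= J.+1)%N then t j else T); split => //.
  move=> j jJ; rewrite jJ; have [jJ'|Jj] := ltnP j J.+1; first exact: tm.
  have -> : j = J.+1 by apply/eqP; rewrite eqn_leq jJ.
  by rewrite tJ.
move=> s k; have [kJ|Jk] := ltnP k J.+1.
  rewrite (ltnW kJ); split=> [[Es [sT _]]|[_ ts]].
    have Esk : E (s, k) by case: Es => // -[_ kE]; move: kJ; rewrite kE ltnn.
    by have [_] := (tE s k).1 (conj Esk (conj sT kJ)).
  have [Es [st0 _]] := (tE s k).2 (conj kJ ts).
  by split; [left|].
split=> [[Es [sT kJ]]|[kJ]].
  have kE : k = J.+1 by apply/eqP; rewrite eqn_leq kJ.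
  rewrite kE leqnn; split => //; rewrite tJ.
  by case: Es => [/topJ|[-> _]//]; rewrite kE ltnn.
have -> : k = J.+1 by apply/eqP; rewrite eqn_leq kJ.
rewrite leqnn tJ => -[Ts sT]; split => //; right.
by congr pair; apply/eqP; rewrite eq_le Ts sT.
Qed.

(** * Almost-everywhere statements and growth rates of absolutely continuous curves *)

Lemma ae_imply (R : realType) (P Q : R -> Prop) : (forall t, P t -> Q t) ->
  (\forall t \ae (@lebesgue_measure R), P t) ->
  \forall t \ae (@lebesgue_measure R), Q t.
Proof.
move=> PQ; apply: negligibleS => t /= nQ Pt; exact/nQ/PQ.
Qed.

Lemma ae_and (R : realType) (P Q : R -> Prop) :
  (\forall t \ae (@lebesgue_measure R), P t) ->
  (\forall t \ae (@lebesgue_measure R), Q t) ->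
  \forall t \ae (@lebesgue_measure R), P t /\ Q t.
Proof.
move=> aP aQ; apply: negligibleS (negligibleU aP aQ) => t /= nPQ.
by apply: contrapT => /not_orP[/contrapT Pt /contrapT Qt]; exact: nPQ.
Qed.

Lemma ae_neq (R : realType) (a : R) : \forall t \ae (@lebesgue_measure R), t <> a.
Proof.
exists [set a]; split => //; first exact: lebesgue_measure_set1.
by move=> t /=; apply: contrapT.
Qed.

Lemma interior_lt_mem (R : realType) (A : set R) t :
  interior A t -> exists2 s, t < s & A s.
Proof.
move=> /nbhs_ballP[e /= e0 H]; exists (t + e / 2).
  by rewrite ltrDl divr_gt0.
apply: H; rewrite /ball /= opprD addrA subrr sub0r normrN gtr0_norm ?divr_gt0 //; lra.
Qed.

Lemma interior_of_between (R : realType) (A : set R) a b t :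
  (forall s, a < s -> s < b -> A s) -> a < t -> t < b -> interior A t.
Proof.
move=> H at_ tb; rewrite /interior.
by apply: filterS2 (lt_nbhsr at_) (lt_nbhsl tb) => s; exact: H.
Qed.

(** By [ac_le], the coordinate times [c] minus [M * t] is nonincreasing. The factor [c] lets one
    statement give upper bounds ([c = 1]) and lower bounds ([c = -1]). *)
Lemma ac_coord_rate (R : realType) (N : nat) (g : R -> 'cV[R]_N) (a b c M : R)
    (i : 'I_N) :
  a <= b -> `|c| <= 1 -> abs_cont_on g a b ->
  (\forall t \ae (@lebesgue_measure R), a <= t -> t <= b ->
     exists2 v, is_derive t 1 g v & c * v i 0 <= M) ->
  c * (g b i 0 - g a i 0) <= M * (b - a).
Proof.
move=> ab c1 acg ae.
suff : c * g b i 0 - M * b <= c * g a i 0 - M * a by rewrite !mulrBr; lra.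
apply: (@ac_le R N g (fun t => c * g t i 0 - M * t) a b (1 + `|M|)) => //.
- move=> y z ay yz zb.
  have -> : c * g z i 0 - M * z - (c * g y i 0 - M * y) =
    c * (g z - g y) i 0 - M * (z - y) by rewrite !mxE; ring.
  apply: le_trans (ler_normB _ _) _; rewrite !normrM [`|z - y|]ger0_norm ?subr_ge0 //.
  have h1 : `|c| * `|(g z - g y) i 0| <= `|g z - g y|.
    by rewrite -[leRHS]mul1r ler_pM // coord_le_norm.
  have h2 : 0 <= z - y by rewrite subr_ge0.
  move: (normr_ge0 M) (normr_ge0 (g z - g y)) h1 h2.
  by move: `|M| `|g z - g y| (`|c| * _) (z - y) => p q r s; nra.
- apply: ae_imply ae => t H at_ tb; have [v dv vM] := H at_ tb.
  exists (c * v i 0 - M); last by rewrite subr_le0.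
  have dgi := is_derive_coord i dv.
  have -> : (fun t => c * g t i 0 - M * t) = c \*: (fun t => g t i 0) - M \*: id.
    by apply/funext.
  by apply: is_derive_eq; rewrite [M *: 1]mulr1.
Qed.

Lemma ac_lipschitz (R : realType) (N : nat) (g : R -> 'cV[R]_N) (a b M : R) :
  0 <= M -> a <= b -> abs_cont_on g a b ->
  (\forall t \ae (@lebesgue_measure R), a <= t -> t <= b ->
     exists2 v, is_derive t 1 g v & `|v| <= M) ->
  `|g b - g a| <= M * (b - a).
Proof.
move=> M0 ab acg ae; apply: norm_le_coord => [|i]; first by rewrite mulr_ge0 // subr_ge0.
have H c : `|c| = 1 -> c * (g b i 0 - g a i 0) <= M * (b - a).
  move=> c1; apply: ac_coord_rate => //; first by rewrite c1.
  apply: ae_imply ae => t H at_ tb; have [v dv vM] := H at_ tb; exists v => //.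
  apply: le_trans (ler_norm _) _; rewrite normrM c1 mul1r.
  exact: le_trans (coord_le_norm _ _) vM.
rewrite !mxE ler_norml; apply/andP; split; last by have := H 1 (normr1 _); rewrite mul1r.
by have := H (-1) (normrN1 _); rewrite mulN1r lerNl.
Qed.

(** * Prolonging solutions *)

Section SolutionExtension.
Variables (R : realType) (N : nat).
Variables (C : set 'cV[R]_N) (f : 'cV[R]_N -> 'cV[R]_N).
Variables (D : set 'cV[R]_N) (G : 'cV[R]_N -> set 'cV[R]_N).
Variables (dom : set (R * nat)) (phi : R -> nat -> 'cV[R]_N).

Lemma solution_flow_ae j a b :
  is_solution C f D G dom phi -> dom (a, j) -> dom (b, j) ->
  \forall t \ae (@lebesgue_measure R), a <= t -> t <= b ->
    is_derive t 1 (fun s => phi s j) (f (phi t j)).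
Proof.
move=> [[hE _ _] _ /(_ j)[_ ae] _] da db.
by apply: ae_imply ae => t H at_ tb; apply: H; exact: htd_convex at_ tb.
Qed.

Lemma solution_abs_cont j a b :
  is_solution C f D G dom phi -> dom (a, j) -> dom (b, j) -> a <= b ->
  abs_cont_on (fun s => phi s j) a b.
Proof. by move=> [[_ _ /(_ j) ac] _ _ _] da db ab; exact: ac. Qed.

Lemma solution_lipschitz M j a b :
  is_solution C f D G dom phi -> 0 <= M ->
  (forall t, dom (t, j) -> `|f (phi t j)| <= M) ->
  dom (a, j) -> dom (b, j) -> a <= b ->
  `|phi b j - phi a j| <= M * (b - a).
Proof.
move=> sol M0 fM da db ab.
apply: (@ac_lipschitz R N (fun s => phi s j)) => //; first exact: solution_abs_cont da db ab.
apply: ae_imply (solution_flow_ae sol da db) => t H at_ tb.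
exists (f (phi t j)); first exact: H.
by apply: fM; have [[hE _ _] _ _ _] := sol; exact: htd_convex at_ tb.
Qed.

(* [y] continues component [J] from time [T] on; [T] itself may or may not
   already belong to the domain. *)
Lemma maximal_contains_flow (J : nat) (t0 T T' M : R) (y : R -> 'cV[R]_N) :
  maximal_solution C f D G dom phi ->
  (forall s k, dom (s, k) -> (k <= J)%N) ->
  (forall s k, (k < J)%N -> dom (s, k) -> s <= t0) ->
  dom (t0, J) -> t0 <= T -> T <= T' ->
  (forall t, dom (t, J) -> t <= T) ->
  (forall t, t0 <= t -> t < T -> dom (t, J)) ->
  (dom (T, J) -> y T = phi T J) ->
  (T < T' -> C (y T)) ->
  (forall t, T < t -> t < T' -> C (y t) /\ is_derive t 1 y (f (y t))) ->
  0 < M ->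
  (forall a b, dom (a, J) -> dom (b, J) -> a <= b ->
     `|phi b J - phi a J| <= M * (b - a)) ->
  (forall a b, T <= a -> a <= b -> b <= T' -> `|y b - y a| <= M * (b - a)) ->
  (forall a, dom (a, J) -> `|y T - phi a J| <= M * (T - a)) ->
  dom (T', J).
Proof.
move=> [sol maxi] topJ mono dt0 t0T TT' domT domlt yT CyT Hy M0 Mphi My MyT.
have [[hE d00 ac] S0 flow jump] := sol.
pose dom' := [set p : R * nat | dom p \/ [/\ p.2 = J, t0 <= p.1 & p.1 <= T']].
pose phi' t j := if (j == J) && (T <= t) then y t else phi t j.
have hE' : hybrid_time_domain dom' by exact: htd_extend_flow.
have phi'E t j : dom (t, j) -> phi' t j = phi t j.
  rewrite /phi' => dtj; case: eqP => [jJ|//]; case: leP => //= Tt.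
  rewrite jJ in dtj *; have tT : t = T by apply/eqP; rewrite eq_le Tt domT.
  by rewrite tT yT // -tT.
have phi'lt t : t < T -> phi' t J = phi t J.
  by rewrite /phi' => tT; rewrite leNgt tT andbF.
have phi'ge t : T <= t -> phi' t J = y t by rewrite /phi' eqxx => ->.
have phi'neqJ t j : j <> J -> phi' t j = phi t j.
  by rewrite /phi'; case: eqP.
have dom'lt t : dom' (t, J) -> t < T -> dom (t, J).
  by move=> [//|[/= _ t0t _]] tT; exact: domlt.
have dom'le t : dom' (t, J) -> t <= T'.
  by move=> [/domT|[] //]; move=> /le_trans; apply.
have neqJ t j : j <> J -> dom' (t, j) -> dom (t, j).
  by move=> jJ [//|[/= jE]].
suff sol' : is_solution C f D G dom' phi'.
  rewrite -(maxi dom' phi' sol') //; first by right; split => //=; exact: le_trans TT'.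
  by move=> p dp; left.
split.
- split => //; first by left.
  move=> j a b da db ab.
  have [jJ|/eqP jJ] := eqVneq j J; last first.
    have -> : (fun t => phi' t j) = (fun t => phi t j).
      by apply/funext => t; exact: phi'neqJ.
    by apply: ac => //; exact: neqJ.
  (* Absolute continuity of the glued arc is obtained from the common Lipschitz constant [M]; an
     interval that crosses [T] is cut there. *)
  rewrite jJ in da db *; apply: (lipschitz_abs_cont M0) => u v au uv vb.
  have du : dom' (u, J) by apply: htd_convex hE' da db au (le_trans uv vb).
  have dv : dom' (v, J) by apply: htd_convex hE' da db (le_trans au uv) vb.
  have [Tu|uT] := leP T u.
    have Tv := le_trans Tu uv; rewrite !phi'ge //.
    by apply: My => //; exact: dom'le.
  have [Tv|vT] := leP T v; last first.
    by rewrite !phi'lt //; apply: Mphi => //; exact: dom'lt.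
  rewrite phi'ge // phi'lt //.
  apply: le_trans (ler_distD (y T) _ _) _.
  have h1 := My T v (lexx _) Tv (dom'le _ dv).
  have h2 := MyT u (dom'lt _ du uT).
  by apply: le_trans (lerD h1 h2) _; rewrite -mulrDr subrKA.
- by rewrite phi'E.
- move=> j; have [jJ|/eqP jJ] := eqVneq j J; last first.
    have domE : [set s | dom' (s, j)] = [set s | dom (s, j)].
      by apply/seteqP; split => s /=; [exact: neqJ|left].
    have phiE : (fun t => phi' t j) = (fun t => phi t j).
      by apply/funext => t; exact: phi'neqJ.
    rewrite domE phiE; have [fl1 fl2] := flow j; split=> [t it|].
      by rewrite phi'neqJ //; exact: fl1.
    by apply: ae_imply fl2 => t H dt; rewrite phi'neqJ //; exact: H.
  rewrite jJ; have [fl1 fl2] := flow J; split=> [t it|].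
    have [tT|Tt] := ltP t T.
      rewrite phi'lt //; apply: fl1; rewrite /interior.
      by apply: filterS2 it (lt_nbhsl tT) => s; exact: dom'lt.
    have [s ts /dom'le sT'] := interior_lt_mem it.
    have tT' := lt_le_trans ts sT'.
    rewrite phi'ge //; move: Tt; rewrite le_eqVlt => /orP[/eqP tE|Tt].
      by rewrite -tE; apply: CyT; rewrite tE.
    by have [] := Hy t Tt tT'.
  (* The derivative may fail at the junction [T] and at the end [T'], a null set; elsewhere the new
     arc agrees locally with [phi] or with [y]. *)
  apply: ae_imply (ae_and fl2 (ae_and (ae_neq T) (ae_neq T'))) => t [H [tnT tnT']] /= dt.
  have [tT|Tt] := ltP t T.
    rewrite phi'lt //; apply: near_eq_is_derive (H (dom'lt _ dt tT)) => //.
    by apply: filterS (lt_nbhsl tT) => s sT; rewrite phi'lt.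
  have {}Tt : T < t by rewrite lt_neqAle Tt andbT; apply/eqP => E; apply: tnT.
  have tT' : t < T' by rewrite lt_neqAle dom'le // andbT; apply/eqP.
  rewrite phi'ge ?ltW //; have [_ dy] := Hy t Tt tT'.
  apply: near_eq_is_derive dy => //.
  by apply: filterS (lt_nbhsr Tt) => s Ts; rewrite phi'ge // ltW.
- move=> t j; have [dtj|ndtj] := pselect (dom (t, j)); last first.
    move=> [//|[/= jJ _ _]] [|[/= jJ' _ _]].
      by move=> /topJ; rewrite jJ ltnn.
    by move: jJ' => /eqP; rewrite jJ (gtn_eqF (ltnSn J)).
  have [dtj'|ndtj'] := pselect (dom (t, j.+1)).
    by move=> _ _; rewrite !phi'E //; exact: jump.
  (* The prolongation creates no new jump into component [J]: it would have to happen at [t0], where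
     that component is already in [dom]. *)
  move=> _ [//|[/= jJ t0t _]]; exfalso; apply: ndtj'.
  have tt0 : t <= t0 by apply: mono dtj; rewrite -jJ.
  by rewrite jJ (_ : t = t0) //; apply/eqP; rewrite eq_le tt0.
Qed.

(** The added component is a single time: it has empty interior, zero length and null measure, so
    only the jump condition has content there. *)
Lemma maximal_contains_jump (J : nat) (T : R) (g : 'cV[R]_N) :
  maximal_solution C f D G dom phi ->
  (forall s k, dom (s, k) -> (k <= J)%N) -> dom (T, J) ->
  D (phi T J) -> G (phi T J) g -> dom (T, J.+1).
Proof.
move=> [sol maxi] topJ dT DT Gg.
have [[hE d00 ac] S0 flow jump] := sol.
pose dom' := [set p : R * nat | dom p \/ p = (T, J.+1)].
pose phi' t j := if j == J.+1 then g else phi t j.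
have phi'E t j : dom (t, j) -> phi' t j = phi t j.
  by rewrite /phi' => /topJ jJ; rewrite ltn_eqF.
have phi'Jt t j : j <> J.+1 -> phi' t j = phi t j by rewrite /phi'; case: eqP.
have phi'J j : j <> J.+1 -> (fun t => phi' t j) = (fun t => phi t j).
  by move=> jJ; apply/funext => t; exact: phi'Jt.
have dom'J j : j <> J.+1 -> [set s | dom' (s, j)] = [set s | dom (s, j)].
  by move=> jJ; apply/seteqP; split => s /=; [case=> // -[_]|left].
have dom'S t : dom' (t, J.+1) -> t = T.
  by move=> [/topJ|[]//]; rewrite ltnn.
suff sol' : is_solution C f D G dom' phi'.
  rewrite -(maxi dom' phi' sol') //; first by right.
  by move=> p dp; left.
split.
- split; [exact: htd_extend_jump|by left|].
  move=> j; have [->|/eqP jJ] := eqVneq j J.+1; last by rewrite phi'J // dom'J.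
  move=> a b /= /dom'S -> /dom'S -> _ e e0; exists 1 => // K u v uv _ _.
  rewrite big1 // => k _; have [u1 [u2 u3]] := uv _ (ltn_ord k).
  by rewrite (_ : phi' (v k) _ = phi' (u k) J.+1) ?subrr ?normr0 // /phi' eqxx.
- by rewrite phi'E.
- move=> j; have [->|/eqP jJ] := eqVneq j J.+1; last first.
    rewrite dom'J // phi'J //; have [fl1 fl2] := flow j; split=> [t it|].
      by rewrite phi'Jt //; exact: fl1.
    by apply: ae_imply fl2 => t H dt; rewrite phi'Jt //; exact: H.
  split=> [t it|].
    have := interior_subset it => /= /dom'S tT.
    by have [s ts /= /dom'S sT] := interior_lt_mem it; move: ts; rewrite tT sT ltxx.
  by apply: ae_imply (ae_neq T) => t tT /= /dom'S.
- move=> t j; have [dtj|ndtj] := pselect (dom (t, j)); last first.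
    move=> [//|[tT jJ]] [/topJ|[_ jE]]; first by rewrite jJ ltnNge leqnSn.
    by move: jE => /eqP; rewrite jJ (gtn_eqF (ltnSn _)).
  move=> _ [dtj'|[tT jJ]]; first by rewrite !phi'E //; exact: jump.
  by rewrite phi'E // /phi' jJ eqxx tT.
Qed.
End SolutionExtension.

(** * Solutions of the closed loop *)

Lemma exists_pos_lb (R : realType) (I : finType) (e : R) (F : I -> R) :
  0 < e -> (forall i, 0 < F i) ->
  exists h, [/\ 0 < h, h <= e & forall i, h <= F i].
Proof.
move=> e0 F0; exists (\big[Num.min/e]_i F i); split.
- by apply: lt_bigmin => // i _; exact: F0.
- exact: bigmin_le_id.
- by move=> i; exact: bigmin_le_cond.
Qed.

Lemma nat_max_ex (P : nat -> Prop) (B : nat) :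
  (exists j, P j) -> (forall j, P j -> (j <= B)%N) ->
  exists2 J, P J & forall j, P j -> (j <= J)%N.
Proof.
move=> [j0 Pj0] PB.
have ex : exists j, `[< P j >] by exists j0; exact/asboolP.
have ub j : `[< P j >] -> (j <= B)%N by move=> /asboolP; exact: PB.
case: (ex_maxnP ex ub) => J /asboolP PJ JM; exists J => // j Pj.
by apply: JM; exact/asboolP.
Qed.

Section ClosedLoopSolutions.
Variables (R : realType) (n m q : nat) (ns : 'I_q -> nat).
Variables (A : 'M[R]_n) (B : 'M[R]_(n, m)) (K : 'M[R]_(m, n)) (ub : 'cV[R]_m).
Variables (T1 T2 : 'I_q -> R).
Hypotheses (ub0 : forall i, 0 < ub i 0) (T10 : forall i, 0 < T1 i).
Hypothesis (T12 : forall i, T1 i <= T2 i).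
Variables (dom : set (R * nat)) (phi : R -> nat -> 'cV[R]_(n + n + q)).

Local Notation Cx := (@Ccl R n q T2).
Local Notation Dx := (@Dcl R n q T2).
Local Notation Gx := (Gcl ns T1 T2).
Local Notation fx := (fcl A B K ub).
Local Notation solution := (is_solution Cx fx Dx Gx).

Lemma tauE (x : 'cV[R]_(n + n + q)) i : tau x i 0 = x (rshift (n + n) i) 0.
Proof. by rewrite /tau mxE. Qed.

Lemma tau_fcl (x : 'cV[R]_(n + n + q)) i : tau (fx x) i 0 = -1.
Proof. by rewrite /tau /fcl col_mxKd mxE. Qed.

(** Stated for arbitrary curves so that it also covers the curve given by Picard iteration, before
    that curve is known to stay in [Cx]. *)
Lemma tau_ac (g : R -> 'cV[R]_(n + n + q)) a b i :
  a <= b -> abs_cont_on g a b ->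
  (\forall t \ae (@lebesgue_measure R), a <= t -> t <= b ->
    is_derive t 1 g (fx (g t))) ->
  tau (g b) i 0 = tau (g a) i 0 - (b - a).
Proof.
move=> ab acg ae; rewrite !tauE.
have fE t : fx (g t) (rshift (n + n) i) 0 = -1 by rewrite -tauE tau_fcl.
have h1 : 1 * (g b (rshift (n + n) i) 0 - g a (rshift (n + n) i) 0) <= -1 * (b - a).
  apply: ac_coord_rate => //; first by rewrite normr1.
  apply: ae_imply ae => t H at_ tb; exists (fx (g t)); first exact: H.
  by rewrite fE mul1r.
have h2 : -1 * (g b (rshift (n + n) i) 0 - g a (rshift (n + n) i) 0) <= 1 * (b - a).
  apply: ac_coord_rate => //; first by rewrite normrN1.
  apply: ae_imply ae => t H at_ tb; exists (fx (g t)); first exact: H.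
  by rewrite fE mulN1r opprK.
by apply/eqP; rewrite eq_le; apply/andP; split; move: h1 h2; lra.
Qed.

Lemma tau_flow a b j i : solution dom phi -> dom (a, j) -> dom (b, j) -> a <= b ->
  tau (phi b j) i 0 = tau (phi a j) i 0 - (b - a).
Proof.
move=> sol da db ab; apply: (@tau_ac (fun s => phi s j)) => //.
  exact: solution_abs_cont sol da db ab.
exact: solution_flow_ae sol da db.
Qed.

Lemma closure_Ccl x : closure Cx x -> Cx x.
Proof.
move=> cx i.
have near e : 0 < e -> exists2 y, Cx y & `|tau x i 0 - tau y i 0| < e.
  move=> e0; have [y [Cy xy]] := cx _ (nbhsx_ballx x e e0).
  exists y => //; apply: le_lt_trans (_ : `|x - y| < e); last by rewrite -ball_normE in xy.
  by rewrite !tauE; have := coord_le_norm (x - y) (rshift (n + n) i); rewrite !mxE.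
split; apply/ler_addgt0Pr => e e0; have [y /(_ i)[y0 y2]] := near e e0;
  rewrite ltr_norml => /andP[]; lra.
Qed.

Lemma Dcl_Ccl x : Dx x -> Cx x.
Proof. by move=> [i []]. Qed.

Lemma Gcl_Ccl x g : Gx x g -> Cx g.
Proof.
move=> [i [[xT xi] _ _ [g1 g2] gk]] k; have [->|ki] := eqVneq k i; last by rewrite gk.
by split => //; apply: le_trans g1; exact: ltW.
Qed.

Lemma solution_in_Ccl t j : solution dom phi -> dom (t, j) -> Cx (phi t j).
Proof.
move=> sol; have [[hE d00 _] S0 flow jump] := sol.
apply: (@hybrid_ind _ dom (fun t j => Cx (phi t j))) => //.
- by case: S0 => [/closure_Ccl|/Dcl_Ccl].
- move=> {t j} s t j ds dt; rewrite le_eqVlt => /orP[/eqP<-//|st] Cs i.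
  have tt := tau_flow i sol ds dt (ltW st).
  have [s0 s2] := Cs i; split; last by lra.
  rewrite leNgt; apply/negP => tneg.
  (* A solution is constrained to [Cx] only in the interior of a flow interval. Going back by [h]
     from [t] reaches an interior time at which the timer is still negative. *)
  have [h [h0 hst ht]] : exists h, [/\ 0 < h, h < t - s & h < - tau (phi t j) i 0].
    exists (Num.min (t - s) (- tau (phi t j) i 0) / 2).
    have : 0 < Num.min (t - s) (- tau (phi t j) i 0).
      by rewrite lt_min subr_gt0 st oppr_gt0.
    have : Num.min (t - s) (- tau (phi t j) i 0) <= t - s by rewrite ge_min lexx.
    have : Num.min (t - s) (- tau (phi t j) i 0) <= - tau (phi t j) i 0.
      by rewrite ge_min lexx orbT.
    by move: (Num.min _ _) => e; split; lra.
  have dr : dom (t - h, j) by apply: htd_convex hE ds dt _ _; lra.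
  have /(_ i)[] : Cx (phi (t - h) j).
    apply: (flow j).1; apply: (@interior_of_between _ _ s t) => [r sr rt||] /=; try lra.
    by apply: htd_convex hE ds dt _ _; exact: ltW.
  have := tau_flow i sol dr dt; lra.
- by move=> {t j} t j dt dt' _; have [_ /Gcl_Ccl] := jump t j dt dt'.
Qed.

Lemma no_flow_after_jump s t j :
  solution dom phi -> dom (t, j) -> dom (t, j.+1) -> dom (s, j) -> s <= t.
Proof.
move=> sol dt dt' ds; rewrite leNgt; apply/negP => ts.
have [_ _ _ jump] := sol; have [[i [_ ti]] _] := jump t j dt dt'.
have := tau_flow i sol dt ds (ltW ts); rewrite ti.
by have /(_ i)[] := solution_in_Ccl sol ds; lra.
Qed.

Lemma solution_dom_mono s k t J : solution dom phi ->
  dom (s, k) -> dom (t, J) -> (k < J)%N -> s <= t.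
Proof.
move=> sol ds dt kJ; have [[hE _ _] _ _ _] := sol.
have [r [dr dr' rt]] := htd_jump_time hE dt kJ.
exact: le_trans (no_flow_after_jump sol dr dr' ds) rt.
Qed.

(* Every jump raises [\sum_i tau_i / T1_i] by at least one. *)
Lemma jump_count t j : solution dom phi -> dom (t, j) ->
  j%:R <= \sum_i T2 i / T1 i + t * \sum_i (T1 i)^-1.
Proof.
move=> sol dtj; have [[hE d00 _] _ _ jump] := sol.
pose S (x : 'cV[R]_(n + n + q)) := \sum_i tau x i 0 / T1 i.
have inv i : 0 < (T1 i)^-1 by rewrite invr_gt0.
have key : j%:R <= S (phi t j) + t * \sum_i (T1 i)^-1.
  apply: (@hybrid_ind _ dom
    (fun t j => j%:R <= S (phi t j) + t * \sum_i (T1 i)^-1)) (dtj) => //.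
  - rewrite mul0r addr0; apply: sumr_ge0 => i _.
    by apply: mulr_ge0; [have /(_ i)[] := solution_in_Ccl sol d00|exact: ltW].
  - move=> {t j dtj} s t j ds dt st.
    have -> : S (phi s j) = S (phi t j) + (t - s) * \sum_i (T1 i)^-1.
      rewrite /S mulr_sumr -big_split /=; apply: eq_bigr => i _.
      by rewrite (tau_flow i sol ds dt st); ring.
    by move/le_trans; apply; rewrite -addrA -mulrDl subrK.
  - move=> {t j dtj} t j dt dt' IH.
    have [_ [i [[_ xi] _ _ [g1 _] gk]]] := jump t j dt dt'.
    apply: (@le_trans _ _ (1 + (S (phi t j) + t * \sum_i (T1 i)^-1))).
      by rewrite -natr1 addrC lerD2l.
    rewrite addrA lerD2r /S (bigD1 i) //= [leRHS](bigD1 i) //= xi mul0r add0r.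
    have -> : \sum_(k < q | k != i) tau (phi t j.+1) k 0 / T1 k =
        \sum_(k < q | k != i) tau (phi t j) k 0 / T1 k.
      by apply: eq_bigr => k /gk ->.
    by rewrite lerD2r ler_pdivlMr // mul1r.
apply: le_trans key _; rewrite lerD2r; apply: ler_sum => i _.
by rewrite ler_wpM2r ?(ltW (inv i)) //; have /(_ i)[] := solution_in_Ccl sol dtj.
Qed.

Lemma Gcl_nonempty x : Dx x -> exists g, Gx x g.
Proof.
move=> [i [xT xi]].
pose v : 'cV[R]_q := \col_k (if k == i then T2 i else tau x k 0).
exists (col_mx (col_mx (xp x) (hblk ns i (Defs.eta x))) v), i.
split => //.
- by rewrite /xp /xbar !col_mxKu.
- by rewrite /Defs.eta /xbar col_mxKu col_mxKd.
- by rewrite /tau col_mxKd mxE eqxx; split.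
- by move=> k /negbTE ki; rewrite {1}/tau col_mxKd mxE ki.
Qed.

Lemma flow_from (x : 'cV[R]_(n + n + q)) (T : R) : Cx x -> ~ Dx x ->
  exists (y : R -> 'cV[R]_(n + n + q)) (h M : R),
  [/\ 0 < h /\ 0 < M, y T = x,
      forall t, T < t -> t < T + h -> Cx (y t) /\ is_derive t 1 y (fx (y t)) &
      forall s t, `|y t - y s| <= M * `|t - s|].
Proof.
move=> Cxx nDx; have [L L0 Lf] := @fcl_lipschitz R n m q A B K ub ub0.
have taupos i : 0 < tau x i 0.
  rewrite lt_neqAle; have [x0 _] := Cxx i; rewrite x0 andbT; apply/eqP => xi.
  by apply: nDx; exists i; split => //; exact: Cxx.
have L20 : 0 < (2 * L)^-1 by rewrite invr_gt0 mulr_gt0.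
(* [h] is small enough both for the contraction and for no timer to become negative before
   [T + h]. *)
have [h [h0 hL htau]] := exists_pos_lb L20 taupos.
have hL' : h * L <= 1 / 2.
  apply: le_trans (ler_wpM2r (ltW L0) hL) _.
  by rewrite invfM -mulrA mulVf ?mulr1 ?div1r // gt_eqF.
have [z [M [M0 z0 dz zM]]] := @picard_lindelof R _ fx L h x L0 Lf h0 hL'.
pose y t := z (t - T).
have yM s t : `|y t - y s| <= M * `|t - s|.
  by apply: le_trans (zM _ _) _; rewrite opprB addrA subrK.
have dy t : T < t -> t < T + h -> is_derive t 1 y (fx (y t)).
  move=> Tt tTh; apply: is_derive_col => i.
  have dzi : is_derive (t - T) 1 (fun s => z s i 0) (fx (z (t - T)) i 0).
    by apply: is_derive_coord; apply: dz; lra.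
  have ds : is_derive t 1 (fun s => s - T) (1 : R).
    have -> : (fun s => s - T) = id - cst T by apply/funext.
    by apply: is_derive_eq; rewrite subr0.
  have := @is_derive1_comp R (fun s => z s i 0) (fun s => s - T) t _ _ dzi ds.
  by rewrite mulr1.
exists y, h, M; split => //.
  by rewrite /y subrr.
move=> t Tt tTh; split; last exact: dy.
have ac : abs_cont_on y T t.
  apply: (lipschitz_abs_cont M0) => u v _ uv _.
  by apply: le_trans (yM _ _) _; rewrite ger0_norm ?subr_ge0.
move=> i; have := @tau_ac y T t i (ltW Tt) ac.
have yT : y T = x by rewrite /y subrr.
rewrite yT => ->; last first.
  apply: ae_imply (ae_neq T) => s sT Ts st; apply: dy; last lra.
  by rewrite lt_neqAle Ts andbT; apply/eqP => E; apply: sT.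
by have := htau i; have [? ?] := Cxx i; split; lra.
Qed.

Lemma maximal_complete (M : R) :
  maximal_solution Cx fx Dx Gx dom phi ->
  (forall t j, dom (t, j) -> `|fx (phi t j)| <= M) ->
  complete_dom dom.
Proof.
move=> maxi fM; have [sol _] := maxi; have [[hE d00 _] _ _ _] := sol.
have M0 : 0 <= M by apply: le_trans (fM _ _ d00).
apply: contrapT => /existsNP[b /forallNP nb].
have tb t j : dom (t, j) -> t + j%:R <= b.
  by move=> dt; rewrite leNgt; apply/negP => bt; apply: (nb t); exists j.
have [J [t0 dt0] topJ] : exists2 J, (exists t, dom (t, J)) &
    forall j, (exists t, dom (t, j)) -> (j <= J)%N.
  apply: (@nat_max_ex (fun j => exists t, dom (t, j)) (Num.bound b)).
    by exists 0%N, 0.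
  move=> j [t dt]; have t0 := htd_ge0 hE dt; have := tb _ _ dt => tjb.
  rewrite -(ler_nat R); apply: le_trans (_ : b <= _); first by lra.
  by apply/ltW/archi_boundP; have := tb _ _ d00; rewrite add0r.
have {}topJ s k : dom (s, k) -> (k <= J)%N by move=> ds; apply: topJ; exists s.
pose I := [set t | dom (t, J)].
have ubI t : dom (t, J) -> t <= b.
  by move=> /tb; have : (0 : R) <= J%:R by []; lra.
have supI : has_sup I by split; [exists t0|exists b => t; exact: ubI].
pose T := sup I.
have domT t : dom (t, J) -> t <= T by move=> dt; apply: ub_le_sup => //; case: supI.
have lip := solution_lipschitz sol (M := M + 1) (j := J).
have {}lip a c : dom (a, J) -> dom (c, J) -> a <= c ->
    `|phi c J - phi a J| <= (M + 1) * (c - a).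
  apply: lip; first by lra.
  by move=> t dt; apply: le_trans (fM _ _ dt) _; lra.
have mono s k t : (k < J)%N -> dom (s, k) -> dom (t, J) -> s <= t.
  by move=> kJ ds dt; exact: (solution_dom_mono sol ds dt kJ).
have [dT|ndT] := pselect (dom (T, J)).
  have [DT|nDT] := pselect (Dx (phi T J)).
    have [g Gg] := Gcl_nonempty DT.
    have := maximal_contains_jump maxi topJ dT DT Gg.
    by move=> /topJ; rewrite ltnn.
  have [y [h [M' [[h0 M'0] yT Hy yM]]]] := @flow_from _ T (solution_in_Ccl sol dT) nDT.
  have : dom (T + h, J).
    apply: (@maximal_contains_flow _ _ _ _ _ _ _ _ J T T (T + h) (M + 1 + M') y maxi) => //.
    - by move=> s k kJ ds; exact: (mono s k T).
    - by lra.
    - by move=> t /le_lt_trans H /H; rewrite ltxx.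
    - by move=> _; rewrite yT; exact: solution_in_Ccl.
    - by lra.
    - move=> a c da dc ac; apply: le_trans (lip a c da dc ac) _.
      by rewrite ler_wpM2r ?subr_ge0 //; lra.
    - move=> a c _ ac _; apply: le_trans (yM a c) _.
      by rewrite ger0_norm ?subr_ge0 // ler_wpM2r ?subr_ge0 //; lra.
    - move=> a da; rewrite yT; apply: le_trans (lip a T da dT (domT a da)) _.
      by rewrite ler_wpM2r ?subr_ge0 ?domT //; lra.
  by move=> /domT; lra.
have domlt t : t0 <= t -> t < T -> dom (t, J).
  rewrite -subr_gt0 => t0t tT; have [s ds ts] := sup_adherent tT supI.
  by apply: htd_convex hE dt0 ds t0t _; apply: ltW; move: ts; rewrite opprB addrC subrK.
have [l Hl] : exists l, forall a : {t | dom (t, J)},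
    `|l - phi (sval a) J| <= (M + 1) * (T - sval a).
  apply: (limit_of_radii (exist (fun t => dom (t, J)) t0 dt0)) => -[a da] [c dc] /=.
  have aT := domT a da; have cT := domT c dc.
  have [ac|ca] := leP a c.
    by rewrite distrC; apply: le_trans (lip a c da dc ac) _; nra.
  by apply: le_trans (lip c a dc da (ltW ca)) _; nra.
apply: (ndT).
(* Prolonging with [T' = T] adds just the missing endpoint; the constant curve [l] supplies its
   value. *)
apply: (@maximal_contains_flow _ _ _ _ _ _ _ _ J t0 T T (M + 1) (fun=> l) maxi) => //.
- by move=> s k kJ ds; exact: (mono s k t0).
- exact: domT.
- by rewrite ltxx.
- by move=> t Tt tT; have := lt_trans Tt tT; rewrite ltxx.
- by lra.
- move=> a c _ ac _; rewrite subrr normr0 mulr_ge0 ?subr_ge0 //; lra.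
- by move=> a da; have := Hl (exist _ a da).
Qed.
End ClosedLoopSolutions.

(** * Lyapunov decay *)

Lemma coord_le_eucl (R : realType) (N : nat) (v : 'cV[R]_N) i : `|v i 0| <= eucl v.
Proof.
rewrite -sqrtr_sqr /eucl ler_wsqrtr // (bigD1 i) //= lerDl.
by apply: sumr_ge0 => j _; exact: sqr_ge0.
Qed.

Lemma expR_increment (R : realType) (y z : R) : y <= z ->
  `|expR z - expR y| <= expR z * (z - y).
Proof.
move=> yz; rewrite ger0_norm ?subr_ge0 ?ler_expR //.
have -> : expR y = expR z * expR (y - z) by rewrite -expRD addrC subrK.
have := expR_ge1Dx (y - z); have := expR_gt0 z.
by move: (expR z) (expR (y - z)) => p r; nra.
Qed.

(** With [e] an exponential of rate [r], and [w], [d] the value and derivative of another function,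
    the left-hand side is the derivative of their product. *)
Lemma weighted_derivative_le0 (R : realType) (e w d r : R) :
  0 < e -> d <= - r * w -> e *: (d : R) + w *: (r * e : R) <= 0.
Proof. by rewrite /GRing.scale /= => e0 dw; nra. Qed.

Lemma ler_powR_inv (R : realType) (k a b : R) : 0 < k -> 0 <= a -> 0 <= b ->
  a `^ k <= b `^ k -> a <= b.
Proof.
move=> k0 a0 b0; apply: contraTT; rewrite -!ltNge => ba.
by apply: gt0_ltr_powR; rewrite ?nnegrE.
Qed.

Lemma powR_root (R : realType) (k a : R) : 0 < k -> 0 <= a -> (a `^ k^-1) `^ k = a.
Proof. by move=> k0 a0; rewrite -powRrM mulVf ?gt_eqF // powRr1. Qed.

(** * Distance to the attractor *)

Section Distance.
Variables (R : realType) (n q : nat) (T2 : 'I_q -> R).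
Hypothesis T20 : forall i, 0 < T2 i.

(** Links the sup norm, in which neighbourhoods are taken, to the Euclidean distance: points of the
    attractor have zero first block, so each coordinate of [xbar x] is one of [x - a]. *)
Lemma xbar_le_distA (x : 'cV[R]_(n + n + q)) : `|xbar x| <= distA T2 x.
Proof.
pose a0 : 'cV[R]_(n + n + q) := col_mx (0 : 'cV[R]_(n + n)) (\col_i T2 i).
apply: lb_le_inf.
  exists (eucl (x - a0)), a0 => //; split; first by rewrite /xbar col_mxKu.
  by move=> i; rewrite /tau col_mxKd mxE; split => //; exact: ltW.
move=> _ [a [a_0 _] <-].
apply: norm_le_coord => [|i]; first exact: sqrtr_ge0.
have -> : xbar x i 0 = (x - a) (lshift q i) 0.
  have : xbar a i 0 = 0 by rewrite a_0 mxE.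
  by rewrite /xbar !mxE => ->; rewrite subr0.
exact: coord_le_eucl.
Qed.

Lemma distA_ge0 (x : 'cV[R]_(n + n + q)) : 0 <= distA T2 x.
Proof. exact: le_trans (xbar_le_distA x). Qed.

(** Used to bound the vector field along a solution: the distance leaves the timers out, but these
    are bounded on the flow set. *)
Lemma Ccl_norm_le (x : 'cV[R]_(n + n + q)) (d : R) :
  @Ccl R n q T2 x -> distA T2 x <= d -> `|x| <= d + \sum_i T2 i.
Proof.
move=> Cx xd; rewrite -(vsubmxK x).
have S0 : 0 <= \sum_i T2 i by apply: sumr_ge0 => i _; exact: ltW.
have d0 : 0 <= d by apply: le_trans xd; exact: distA_ge0.
apply: col_mx_norm_le.
  by apply: le_trans (le_trans (xbar_le_distA x) xd) _; rewrite lerDl.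
apply: norm_le_coord => [|i]; first exact: addr_ge0.
have [x0 x2] := Cx i; rewrite ger0_norm //; apply: le_trans x2 _.
rewrite (bigD1 i) //= addrCA lerDl addr_ge0 //.
by apply: sumr_ge0 => j _; exact: ltW.
Qed.
End Distance.

Section Lyapunov.
Variables (R : realType) (n m q : nat) (ns : 'I_q -> nat).
Variables (A : 'M[R]_n) (B : 'M[R]_(n, m)) (K : 'M[R]_(m, n)) (ub : 'cV[R]_m).
Variables (T1 T2 : 'I_q -> R).
Hypotheses (ub0 : forall i, 0 < ub i 0) (T10 : forall i, 0 < T1 i).
Hypothesis (T12 : forall i, T1 i <= T2 i).
Variables (V : 'cV[R]_(n + n + q) -> R) (k c1 c2 c3 : R) (U : set 'cV[R]_(n + n)).
Hypotheses (VC1 : C1 V) (k0 : 0 < k) (c10 : 0 < c1) (c20 : 0 < c2) (c30 : 0 < c3).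
Hypothesis (nbhsU : nbhs (0 : 'cV[R]_(n + n)) U).

Local Notation Cx := (@Ccl R n q T2).
Local Notation Dx := (@Dcl R n q T2).
Local Notation Gx := (Gcl ns T1 T2).
Local Notation fx := (fcl A B K ub).
Local Notation solution := (is_solution Cx fx Dx Gx).

Hypothesis (Vbounds : forall x, Cx x ->
  c1 * distA T2 x `^ k <= V x /\ V x <= c2 * distA T2 x `^ k).
Hypothesis (Vflow : forall x, U (xbar x) -> Tset T2 (tau x) -> 'd V x (fx x) <= - c3 * V x).
Hypothesis (Vjump : forall x g, Dx x -> Gx x g -> V g - V x <= 0).

Let T20 i : 0 < T2 i. Proof. exact: lt_le_trans (T12 i). Qed.

Lemma V_ge0 x : Cx x -> 0 <= V x.
Proof.
by move=> /Vbounds[h _]; apply: le_trans h; rewrite mulr_ge0 ?powR_ge0 // ltW.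
Qed.

Lemma fcl_continuous : continuous (fx : 'cV[R]_(n + n + q) -> 'cV[R]_(n + n + q)).
Proof.
have [L L0 Lf] := @fcl_lipschitz R n m q A B K ub ub0.
exact: lipschitz_continuous Lf.
Qed.

Section Sublevel.
Variable c : R.
Hypothesis sub : [set x | Cx x /\ V x <= c] `<=` [set x | U (xbar x) /\ Tset T2 (tau x)].

(* On the boundary [V x = c] of the sublevel set, [U] need not contain a
   neighbourhood of [x]; there the derivative is negative by continuity, except
   when [c = 0], where [x] lies in the attractor, inside [U]. *)
Lemma nonincreasing_near x : Cx x -> V x <= c ->
  exists2 r, 0 < r & forall w, Cx w -> `|w - x| < r -> 'd V w (fx w) <= 0.
Proof.
move=> Cxx Vxc.
suff : nbhs x [set w | Cx w -> 'd V w (fx w) <= 0].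
  move=> /nbhs_ballP[r /= r0 H]; exists r => // w Cw wx; apply: H => //.
  by rewrite -ball_normE /= distrC.
have leU w : U (xbar w) -> Cx w -> 'd V w (fx w) <= 0.
  move=> Uw Cw; apply: le_trans (Vflow Uw Cw) _.
  by rewrite mulNr oppr_le0 mulr_ge0 ?(ltW c30) // V_ge0.
have [Vx|cVx] := ltP (V x) c.
  have cV : V w @[w --> x] --> V x by apply: differentiable_continuous; exact: VC1.1.
  have /nbhs_ballP[r /= r0 rV] := cV _ (lt_nbhsl Vx).
  apply/nbhs_ballP; exists r => //= w /rV /= Vw Cw; apply: leU => //.
  by have [] := sub (conj Cw (ltW Vw)).
have VxE : V x = c by apply/eqP; rewrite eq_le Vxc.
have := V_ge0 Cxx; rewrite le_eqVlt => /orP[/eqP Vx0|Vx0]; last first.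
  have dVneg : 'd V x (fx x) < 0.
    have [Ux _] := sub (conj Cxx Vxc); apply: le_lt_trans (Vflow Ux Cxx) _.
    by rewrite mulNr oppr_lt0 mulr_gt0.
  have cdV := C1_diff_continuous VC1 fcl_continuous.
  have /nbhs_ballP[r /= r0 rV] := cdV x _ (lt_nbhsl dVneg).
  by apply/nbhs_ballP; exists r => //= w /rV /= wneg _; exact: ltW.
have x0 : xbar x = 0.
  apply/eqP; rewrite -normr_le0; apply: le_trans (xbar_le_distA T20 x) _.
  have [h _] := Vbounds Cxx; rewrite -Vx0 pmulr_rle0 // in h.
  have : distA T2 x `^ k == 0 by rewrite eq_le h powR_ge0.
  by rewrite powR_eq0 => /andP[/eqP -> _].
have /nbhs_ballP[r /= r0 rU] := nbhsU.
apply/nbhs_ballP; exists r => //= w xw Cw; apply: leU => //; apply: rU.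
rewrite -ball_normE /= -x0; rewrite -ball_normE /= in xw.
by apply: le_lt_trans xw; rewrite /xbar -linearB; exact: usubmx_norm_le.
Qed.

Variables (dom : set (R * nat)) (phi : R -> nat -> 'cV[R]_(n + n + q)).
Hypothesis (sol : solution dom phi).

Lemma V_derive_ae a b j : dom (a, j) -> dom (b, j) ->
  \forall t \ae (@lebesgue_measure R), a <= t -> t <= b ->
    is_derive t 1 (fun s => V (phi s j)) ('d V (phi t j) (fx (phi t j))).
Proof.
move=> da db; apply: ae_imply (solution_flow_ae sol da db) => t H at_ tb.
by apply: is_derive_comp_diff; [exact: VC1.1|exact: H].
Qed.

Lemma lyapunov_flow a b j : dom (a, j) -> dom (b, j) -> a <= b -> V (phi a j) <= c ->
  V (phi b j) <= expR (- c3 * (b - a)) * V (phi a j).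
Proof.
move=> da db ab Vac.
have [[hE _ _] _ _ _] := sol.
have acab := solution_abs_cont sol da db ab.
have dab t : a <= t -> t <= b -> dom (t, j) by move=> *; exact: htd_convex hE da db _ _.
have Cab t : a <= t -> t <= b -> Cx (phi t j).
  by move=> at_ tb; apply: (solution_in_Ccl T10 sol); exact: dab.
have Va0 := V_ge0 (Cab a (lexx a) ab).
have Vle t : a <= t -> V (phi t j) <= expR (- c3 * (t - a)) * V (phi a j) ->
    V (phi t j) <= c.
  move=> at_ /le_trans; apply; apply: le_trans Vac; rewrite -[leRHS]mul1r ler_wpM2r //.
  by rewrite -expR0 ler_expR mulNr oppr_le0 mulr_ge0 ?(ltW c30) // subr_ge0.
apply: (@real_induction R a b
  (fun t => V (phi t j) <= expR (- c3 * (t - a)) * V (phi a j))) => //.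
  by rewrite subrr mulr0 expR0 mul1r.
move=> x ax xb.
(* Above level [c] the step is vacuous: by continuity [V] exceeds [c] at [y] too, against the
   induction hypothesis. *)
have [Vx|cVx] := leP (V (phi x j)) c; last first.
  have cV : V w @[w --> phi x j] --> V (phi x j).
    by apply: differentiable_continuous; exact: VC1.1.
  have /nbhs_ballP[r /= r0 rV] := cV _ (lt_nbhsr cVx).
  have [d d0 Hd] := abs_cont_continuous acab r0 ax xb.
  exists d => // y z ay yx xz zb xdy zxd Py; exfalso.
  have : V (phi y j) <= c by exact: Vle.
  rewrite leNgt => /negP; apply; apply: rV; rewrite -ball_normE /= distrC.
  apply: Hd => //; first exact: le_trans yx xb.
  by rewrite ler0_norm ?subr_le0 // opprB ltrBlDr -ltrBlDl.
have [r1 r10 Hr1] := nonincreasing_near (Cab x ax xb) Vx.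
have [r2 [L [r20 L0 HL]]] := C1_locally_lipschitz (phi x j) VC1.
pose r := Num.min r1 r2; have r0 : 0 < r by rewrite lt_min r10.
have [d d0 Hd] := abs_cont_continuous acab r0 ax xb.
exists d => // y z ay yx xz zb xdy zxd Py.
have yz := le_trans yx xz.
have ins s : y <= s -> s <= z -> a <= s /\ s <= b.
  by move=> ys sz; split; [exact: le_trans ys|exact: le_trans zb].
have phir s : y <= s -> s <= z -> `|phi s j - phi x j| < r.
  move=> ys sz; have [as_ sb] := ins s ys sz; apply: Hd => //.
  by rewrite ltr_norml; apply/andP; split; lra.
have lipV u v : y <= u -> u <= v -> v <= z ->
    `|V (phi v j) - V (phi u j)| <= L * `|phi v j - phi u j|.
  move=> yu uv vz; apply: HL.
    by apply: lt_le_trans (phir u yu (le_trans uv vz)) _; rewrite ge_min lexx orbT.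
  by apply: lt_le_trans (phir v (le_trans yu uv) vz) _; rewrite ge_min lexx orbT.
have [ayy yb] := ins y (lexx y) yz; have [az zb'] := ins z yz (lexx z).
(* First pass, with only the sign of the derivative near [phi x j], as the arc is not yet known to
   stay over [U]. *)
have Vmono s : y <= s -> s <= z -> V (phi s j) <= V (phi y j).
  move=> ys sz; have [as_ sb] := ins s ys sz.
  apply: (@ac_le R _ (fun t => phi t j) (fun t => V (phi t j)) y s L) => //.
  - exact: abs_cont_sub ay sb acab.
  - move=> u v yu uv vs; apply: le_trans (lipV u v yu uv (le_trans vs sz)) _.
    by rewrite ler_wpM2l // lerDl subr_ge0.
  - apply: ae_imply (V_derive_ae (dab y ay yb) (dab s as_ sb)) => t H yt ts.
    exists ('d V (phi t j) (fx (phi t j))); first exact: H.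
    have [at_ tb] := ins t yt (le_trans ts sz).
    apply: Hr1; first exact: Cab.
    by apply: lt_le_trans (phir t yt (le_trans ts sz)) _; rewrite ge_min lexx.
have Vyc : V (phi y j) <= c by exact: Vle.
have Vsc s : y <= s -> s <= z -> V (phi s j) <= c.
  by move=> ys sz; exact: le_trans (Vmono s ys sz) Vyc.
have c0 : 0 <= c by apply: le_trans Vyc; apply: V_ge0; exact: Cab.
(* Second pass: the arc now lies in the sublevel set, so the rate [c3] applies. The constant adds
   [L] weighted by the largest exponential to the bound [c] on [V] times a Lipschitz constant of the
   exponential. *)
have decay : expR (c3 * z) * V (phi z j) <= expR (c3 * y) * V (phi y j).
  apply: (@ac_le R _ (fun t => phi t j) (fun t => expR (c3 * t) * V (phi t j)) y z
    (expR (c3 * z) * L + c * (expR (c3 * z) * c3))) => //.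
  - by rewrite addr_ge0 // !mulr_ge0 ?expR_ge0 // ltW.
  - exact: abs_cont_sub ay zb acab.
  - move=> u v yu uv vz; have [au ub'] := ins u yu (le_trans uv vz).
    have -> : expR (c3 * v) * V (phi v j) - expR (c3 * u) * V (phi u j) =
      expR (c3 * v) * (V (phi v j) - V (phi u j)) +
      V (phi u j) * (expR (c3 * v) - expR (c3 * u)) by ring.
    apply: le_trans (ler_normD _ _) _; rewrite !normrM mulrDl.
    have ez : expR (c3 * v) <= expR (c3 * z) by rewrite ler_expR ler_wpM2l // ltW.
    apply: lerD.
      rewrite ger0_norm ?expR_ge0 // -mulrA; apply: ler_pM => //.
      apply: le_trans (lipV u v yu uv vz) _.
      by rewrite ler_wpM2l // lerDl subr_ge0.
    rewrite -[leRHS]mulrA; apply: ler_pM => //.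
      by rewrite ger0_norm ?Vsc ?V_ge0 //; [exact: le_trans uv vz|exact: Cab].
    have uv3 : c3 * u <= c3 * v by rewrite ler_wpM2l // ltW.
    apply: le_trans (expR_increment uv3) _; rewrite -mulrBr -mulrA.
    apply: ler_pM => //.
      by rewrite mulr_ge0 ?subr_ge0 // ltW.
    by rewrite ler_wpM2l ?(ltW c30) // lerDr.
  - apply: ae_imply (V_derive_ae (dab y ay yb) (dab z az zb)) => t H yt tz.
    have dW := H yt tz; have [at_ tb] := ins t yt tz.
    have dE : is_derive t (1 : R) (fun s => expR (c3 * s)) (c3 * expR (c3 * t)).
      have dl : is_derive t (1 : R) (fun s => c3 * s) c3.
        have -> : (fun s => c3 * s) = c3 \*: id by apply/funext.
        by apply: is_derive_eq; rewrite [_ *: 1]mulr1.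
      have := @is_derive1_comp R expR (fun s => c3 * s) t _ _ (is_derive_expR _) dl.
      by rewrite mulrC.
    exists (expR (c3 * t) *: 'd V (phi t j) (fx (phi t j)) +
            V (phi t j) *: (c3 * expR (c3 * t))).
      exact: (is_deriveM dE dW).
    have [Ut Tt] := sub (conj (Cab t at_ tb) (Vsc t yt tz)).
    exact: weighted_derivative_le0 (expR_gt0 _) (Vflow Ut Tt).
have ezy : expR (- c3 * (z - a)) =
    expR (- (c3 * z)) * (expR (c3 * y) * expR (- c3 * (y - a))).
  by rewrite -!expRD; congr expR; ring.
rewrite ezy -mulrA -[leLHS]mul1r -(expR0 R) -(addNr (c3 * z)) expRD -mulrA.
apply: ler_wpM2l; first exact: expR_ge0.
apply: le_trans decay _; rewrite -mulrA; apply: ler_wpM2l => //; exact: expR_ge0.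
Qed.

Lemma lyapunov_decay t j : V (phi 0 0%N) <= c -> dom (t, j) ->
  V (phi t j) <= expR (- c3 * t) * V (phi 0 0%N).
Proof.
move=> V0c; have [[hE d00 _] _ _ jump] := sol.
have V00 := V_ge0 (solution_in_Ccl T10 sol d00).
apply: (@hybrid_ind R dom (fun t j => V (phi t j) <= expR (- c3 * t) * V (phi 0 0%N))) => //.
- by rewrite mulr0 expR0 mul1r.
- move=> {t j} s t j ds dt st Vs.
  have s0 := htd_ge0 hE ds.
  have Vsc : V (phi s j) <= c.
    apply: le_trans Vs (le_trans _ V0c); rewrite -[leRHS]mul1r ler_wpM2r //.
    by rewrite -expR0 ler_expR mulNr oppr_le0 mulr_ge0 // ltW.
  apply: le_trans (lyapunov_flow ds dt st Vsc) _.
  apply: le_trans (ler_wpM2l (expR_ge0 _) Vs) _.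
  by rewrite mulrA -expRD -mulrDr subrK.
- move=> {t j} t j dt dt'; have [Dt Gt] := jump t j dt dt'.
  by apply: le_trans; rewrite -subr_le0; exact: Vjump Gt.
Qed.
End Sublevel.

(** * Exponential stability and basin of attraction *)

Lemma sublevel_exponential : exists kappa lambda : R, [/\ 0 < kappa, 0 < lambda &
  forall c, [set x | Cx x /\ V x <= c] `<=` [set x | U (xbar x) /\ Tset T2 (tau x)] ->
  forall dom phi, maximal_solution Cx fx Dx Gx dom phi -> V (phi 0 0%N) <= c ->
    complete_dom dom /\ forall t j, dom (t, j) ->
      distA T2 (phi t j) <=
        kappa * expR (- lambda * (t + j%:R)) * distA T2 (phi 0 0%N)].
Proof.
pose kap0 := (c2 / c1) `^ k^-1.
pose a := \sum_i T2 i / T1 i; pose b := \sum_i (T1 i)^-1.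
have a0 : 0 <= a by apply: sumr_ge0 => i _; rewrite divr_ge0 // ltW.
have b0 : 0 <= b by apply: sumr_ge0 => i _; rewrite invr_ge0 ltW.
have kap00 : 0 < kap0 by rewrite powR_gt0 // divr_gt0.
(* Taking [k]-th roots turns the rate [c3] into [c3 / k]. As [j <= a + b * t], one has
   [t + j <= a + (1 + b) * t]: hence the division by [1 + b] and the factor [expR (lam * a)] in
   [kappa]. *)
pose lam := c3 / k / (1 + b).
have b10 : 0 < 1 + b by lra.
have lam0 : 0 < lam by rewrite !divr_gt0.
exists (kap0 * expR (lam * a)), lam; split => //.
  by rewrite mulr_gt0 // expR_gt0.
move=> c sub dom phi maxi V0c; have [sol _] := maxi; have [[hE d00 _] _ _ _] := sol.
pose d0 := distA T2 (phi 0 0%N).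
have d0ge : 0 <= d0 by exact: distA_ge0.
have est t j : dom (t, j) ->
    distA T2 (phi t j) <= kap0 * expR (- (c3 / k) * t) * d0.
  move=> dt; have Ct := solution_in_Ccl T10 sol dt.
  apply: (ler_powR_inv k0); first exact: distA_ge0.
    by rewrite !mulr_ge0 ?expR_ge0 // ltW.
  rewrite !powRM ?mulr_ge0 ?expR_ge0 ?(ltW kap00) //.
  rewrite powR_root // ?divr_ge0 ?(ltW c10) ?(ltW c20) // -expRM.
  have -> : - (c3 / k) * t * k = - c3 * t by field; rewrite gt_eqF.
  have [h1 _] := Vbounds Ct.
  have [_ h2] := Vbounds (solution_in_Ccl T10 sol d00).
  have h3 := lyapunov_decay sub sol V0c dt.
  rewrite -(ler_pM2l c10); apply: le_trans h1 (le_trans h3 _).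
  apply: le_trans (ler_wpM2l (expR_ge0 _) h2) _; rewrite -/d0 le_eqVlt; apply/orP; left.
  by apply/eqP; field; rewrite gt_eqF.
have est0 t j : dom (t, j) -> distA T2 (phi t j) <= kap0 * d0.
  move=> dt; apply: le_trans (est t j dt) _; rewrite mulrAC -[leRHS]mulr1 ler_wpM2l //.
    by rewrite mulr_ge0 // ltW.
  rewrite -expR0 ler_expR mulNr oppr_le0 mulr_ge0 ?divr_ge0 ?(ltW c30) ?(ltW k0) //.
  exact: htd_ge0 hE dt.
split.
  have [L L0 Lf] := @fcl_lipschitz R n m q A B K ub ub0.
  apply: (@maximal_complete R n m q ns A B K ub T1 T2 ub0 T10 T12 dom phi
    (L * (kap0 * d0 + \sum_i T2 i) + `|fx (0 : 'cV[R]_(n + n + q))|) maxi) => t j dt.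
  rewrite -[X in `|X|](subrK (fx 0)); apply: le_trans (ler_normD _ _) _; rewrite lerD2r.
  apply: le_trans (Lf _ _) _; rewrite ler_wpM2l ?(ltW L0) // subr0.
  by apply: (Ccl_norm_le T20) (est0 t j dt); exact: (solution_in_Ccl T10 sol dt).
move=> t j dt; apply: le_trans (est t j dt) _; rewrite -/d0 ler_wpM2r //.
rewrite -mulrA ler_wpM2l ?(ltW kap00) // -expRD ler_expR.
have jc := jump_count T10 sol dt; rewrite -/a -/b in jc.
have : lam * (t + j%:R) <= lam * (a + t * (1 + b)).
  by rewrite ler_wpM2l ?(ltW lam0) //; lra.
have -> : lam * (a + t * (1 + b)) = lam * a + c3 / k * t.
  by rewrite /lam; field; rewrite !gt_eqF.
lra.
Qed.

Lemma closed_loop_exp_stable : exp_stable Cx fx Dx Gx (distA T2).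
Proof.
have [kappa [lambda [kap0 lam0 H]]] := sublevel_exponential.
have /nbhs_ballP[r /= r0 rU] := nbhsU.
(* By the lower bound on [V], level [c] forces distance at most [r / 2], inside the ball contained
   in [U]. By the upper bound, the radius [mu] chosen below keeps initial states under level [c]. *)
pose c := c1 * (r / 2) `^ k.
have r20 : 0 < r / 2 by rewrite divr_gt0.
have c0 : 0 < c by rewrite mulr_gt0 // powR_gt0.
exists kappa, lambda, ((c / c2) `^ k^-1); split => //.
  by rewrite powR_gt0 // divr_gt0.
move=> dom phi maxi dmu; apply: (H c) => //.
  move=> x [Cxx Vxc]; split => //; apply: rU; rewrite -ball_normE /= sub0r normrN.
  apply: le_lt_trans (xbar_le_distA T20 x) _.
  apply: (@le_lt_trans _ _ (r / 2)); last by lra.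
  apply: (ler_powR_inv k0) => //; [exact: distA_ge0|exact: ltW|].
  by rewrite -(ler_pM2l c10); have [h _] := Vbounds Cxx; exact: le_trans h Vxc.
have [sol _] := maxi; have [[_ d00 _] _ _ _] := sol.
have [_ h] := Vbounds (solution_in_Ccl T10 sol d00); apply: le_trans h _.
have -> : c = c2 * (c / c2) by rewrite mulrC divfK // gt_eqF.
rewrite ler_wpM2l ?(ltW c20) //.
rewrite -[leRHS](powR_root k0); last by rewrite divr_ge0 // ltW.
by apply: ge0_ler_powR; rewrite ?nnegrE ?(ltW k0) ?powR_ge0 ?distA_ge0.
Qed.

Lemma sublevel_basin c :
  [set x | Cx x /\ V x <= c] `<=` [set x | U (xbar x) /\ Tset T2 (tau x)] ->
  [set x | Cx x /\ V x <= c] `<=` basin Cx fx Dx Gx (distA T2).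
Proof.
have [kappa [lambda [kap0 lam0 H]]] := sublevel_exponential.
move=> sub x [Cxx Vxc] dom phi maxi phi0.
have V0c : V (phi 0 0%N) <= c by rewrite phi0.
have [cmpl est] := H c sub dom phi maxi V0c.
split => // e e0; rewrite phi0 in est.
have d0 : 0 <= distA T2 x by exact: distA_ge0.
(* The inequality [1 + s <= expR s] gives an explicit threshold without logarithms. *)
exists (kappa * distA T2 x / e / lambda) => t j dt; rewrite ler_pdivrMr // => Ms.
apply: le_trans (est t j dt) _; move: (t + j%:R) Ms => s Ms.
rewrite mulrAC mulNr expRN ler_pdivrMr ?expR_gt0 //.
rewrite ler_pdivrMr // in Ms; apply: le_trans Ms _.
rewrite mulrC ler_wpM2l ?(ltW e0) //; have := expR_ge1Dx (lambda * s).
by rewrite [s * _]mulrC; lra.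
Qed.
End Lyapunov.

Theorem theorem2 (R : realType) (n m q : nat) (ns : 'I_q -> nat)
    (A : 'M[R]_n) (B : 'M[R]_(n, m)) (K : 'M[R]_(m, n)) (ub : 'cV[R]_m)
    (T1 T2 : 'I_q -> R)
    (V : 'cV[R]_(n + n + q) -> R) (k c1 c2 c3 : R) (U : set 'cV[R]_(n + n)) :
  (1 <= n)%N -> (1 <= m)%N -> (1 <= q)%N -> (q <= n)%N ->
  (forall i, (1 <= ns i)%N) -> (\sum_(i < q) ns i)%N = n ->
  (forall i, 0 < ub i 0) ->
  (forall i, 0 < T1 i) -> (forall i, T1 i <= T2 i) ->
  C1 V -> 0 < k -> 0 < c1 -> 0 < c2 -> 0 < c3 ->
  nbhs (0 : 'cV[R]_(n + n)) U ->
  (forall x, @Ccl R n q T2 x ->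
     c1 * distA T2 x `^ k <= V x /\ V x <= c2 * distA T2 x `^ k) ->
  (forall x, U (xbar x) -> Tset T2 (tau x) ->
     'd V x (fcl A B K ub x) <= - c3 * V x) ->
  (forall x g, @Dcl R n q T2 x -> Gcl ns T1 T2 x g -> V g - V x <= 0) ->
  exp_stable (@Ccl R n q T2) (fcl A B K ub) (@Dcl R n q T2) (Gcl ns T1 T2)
             (distA T2)
  /\
  (forall c : R,
     [set x | @Ccl R n q T2 x /\ V x <= c]
       `<=` [set x | U (xbar x) /\ Tset T2 (tau x)] ->
     [set x | @Ccl R n q T2 x /\ V x <= c]
       `<=` basin (@Ccl R n q T2) (fcl A B K ub) (@Dcl R n q T2)
                  (Gcl ns T1 T2) (distA T2)).
Proof.
move=> _ _ _ _ _ _ ub0 T10 T12 VC1 k0 c10 c20 c30 nU Vb Vf Vj; split.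
  exact: (closed_loop_exp_stable ub0 T10 T12 VC1 k0 c10 c20 c30 nU Vb Vf Vj).
by move=> c; exact: (sublevel_basin ub0 T10 T12 VC1 k0 c10 c20 c30 nU Vb Vf Vj).
Qed.
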